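(* Let $T\in\mathcal{B}(H)$ be invertible with polar decomposition $T=U|T|$. For an operator mean $\mathfrak{m}$ put $\mathfrak{M}_0(U,|T|)=|T|$ and $$\mathfrak{M}_n(U,|T|):=\mathfrak{m}\bigl(U^*\mathfrak{M}_{n-1}(U,|T|)U,\ \mathfrak{M}_{n-1}(U,|T|)\bigr)>0\qquad (n=1,2,\dots).$$ Then the following hold. (i) If $\mathfrak{m}$ is a weighted operator arithmetic mean, then for each non-negative integer $n$ the polar decomposition of $\Delta_{\mathfrak{m}}^{n}(T)$ is $$\Delta_{\mathfrak{m}}^{n}(T)=U\,\mathfrak{M}_n(U,|T|).$$ (ii) If $\mathfrak{m}$ is an (arbitrary) operator mean and $T$ is centered, then for each non-negative integer $n$, $\Delta_{\mathfrak{m}}^{n}(T)$ is centered and its polar decomposition is $$\Delta_{\mathfrak{m}}^{n}(T)=U\,\mathfrak{M}_n(U,|T|).$$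
   Context: $H$ is a complex Hilbert space, $\mathcal{B}(H)$ the bounded linear operators on $H$, $\mathcal{B}(H)_{++}$ the positive invertible ones ($A>0$ means $A\in\mathcal{B}(H)_{++}$), $|T|=(T^*T)^{1/2}$. If $T$ is invertible, $U$ in $T=U|T|$ is unitary. Operator mean: $\mathfrak{m}=\mathfrak{m}_f$ corresponds to a representing function $f:(0,\infty)\to(0,\infty)$, operator monotone with $f(1)=1$; for $A,B\in\mathcal{B}(H)_{++}$, $\mathfrak{m}_f(A,B)=A^{1/2}f(A^{-1/2}BA^{-1/2})A^{1/2}$. A weighted operator arithmetic mean is the one with $f(x)=1-\lambda+\lambda x$ for some $\lambda\in[0,1]$, i.e. $\mathfrak{m}(A,B)=(1-\lambda)A+\lambda B$. Induced Aluthge transformation: for invertible $T=U|T|$ with spectral decomposition $|T|=\int_{\sigma(|T|)}s\,dE_s$, define $\Delta_{\mathfrak{m}_f}(T)=\Delta_f(T):=\int_{\sigma(|T|)}\int_{\sigma(|T|)} s f(t/s)\,dE_s\,U\,dE_t$ (double operator integral). Concretely (known fact), if $\mu$ is a probability measure on $[0,1]$ with $f(x)=\int_0^1[1-\lambda+\lambda x^{-1}]^{-1}d\mu(\lambda)$ for $x>0$ (such $\mu$ exists), then $\Delta_f(T)=\int_0^1\int_0^\infty e^{-(1-\lambda)s|T|^{-1}}\,U\,e^{-\lambda s|T|^{-1}}\,ds\,d\mu(\lambda)$. Iterates: $\Delta_f^0(T)=T$, $\Delta_f^n(T)=\Delta_f(\Delta_f^{n-1}(T))$. $T=U|T|$ is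 centered if $\{U^{*m}|T|U^m,\ |T|,\ U^n|T|U^{*n}: n,m=1,2,\dots\}$ is a commuting set. *)

(* Defs.v *)
From mathcomp Require Import all_boot all_order all_algebra sesquilinear.
From mathcomp Require Import complex.
From mathcomp Require Import all_classical all_reals all_analysis.

Set Implicit Arguments.
Unset Strict Implicit.
Unset Printing Implicit Defensive.

Import Order.TTheory GRing.Theory Num.Theory numFieldNormedType.Exports.

Local Open Scope classical_set_scope.
Local Open Scope ring_scope.
Local Open Scope complex_scope.

(* The inner product is linear in its first argument. *)
Record hilbertType (R : realType) := HilbertType {
  hilbert_sort :> completeNormedModType R[i];
  inner : {dot hilbert_sort for (@Num.conj R[i])};
  inner_norm : forall x : hilbert_sort, `|x| ^+ 2 = inner x x }.
Arguments inner {R} h.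

Section BoundedOperators.
Context (R : realType) (H : hilbertType R).
Implicit Types (A B P S T U : H -> H).

(* B(H) is the set of continuous linear maps; [H -> H] carries the pointwise
   operations, and the product of operators is composition. *)
Definition bounded_op : set (H -> H) := [set A | linear A /\ continuous A].

Definition is_adjoint A S := forall x y, inner H (A x) y = inner H x (S y).

Definition adjoint A : H -> H := get [set S | bounded_op S /\ is_adjoint A S].

Definition is_inverse A S := A \o S = id /\ S \o A = id.

(* invertibility in the algebra B(H): the inverse is bounded *)
Definition invertible_op A :=
  bounded_op A /\ exists2 S, bounded_op S & is_inverse A S.

Definition inverse A : H -> H := get [set S | bounded_op S /\ is_inverse A S].

(* The order of [R[i]] is that of the reals extended by z <= w iff w - z is a
   nonnegative real, so positivity includes <Ax, x> being real. *)
Definition positive_op A := bounded_op A /\ forall x, 0 <= inner H (A x) x.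

Definition pos_invertible A := positive_op A /\ invertible_op A.

Definition op_le A B :=
  [/\ bounded_op A, bounded_op B & positive_op (B \- A)].

(* the positive square root *)
Definition op_sqrt A : H -> H := get [set S | positive_op S /\ S \o S = A].

Definition op_abs T : H -> H := op_sqrt (adjoint T \o T).

Definition partial_isometry U := bounded_op U /\
  forall x, (forall y, U y = 0 -> inner H x y = 0) -> `|U x| = `|x|.

Definition polar_decomposition T U P :=
  [/\ T = U \o P, P = op_abs T, partial_isometry U
    & forall x, U x = 0 <-> T x = 0].

Definition polar_factor T : H -> H :=
  get [set U | polar_decomposition T U (op_abs T)].

Definition centered T :=
  let U := polar_factor T in
  let orbit := [set X | exists n,
        X = iter n (adjoint U) \o op_abs T \o iter n U
     \/ X = iter n U \o op_abs T \o iter n (adjoint U)] in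
  forall X Y, orbit X -> orbit Y -> X \o Y = Y \o X.

End BoundedOperators.

Section SpectralIntegrals.
Context (R : realType) (H : hilbertType R).
Implicit Types (A X Y : H -> H) (E : R -> H -> H) (f : R -> R).

Definition orthogonal_projection A :=
  [/\ bounded_op A, A \o A = A & is_adjoint A A].

(* a tagged partition of [a, b]: the points are a :: s, the i-th tag is t i *)
Definition tagged_partition (a b : R) (s : seq R) (t : nat -> R) :=
  itv_partition a b s /\
  forall i, (i < size s)%N -> nth b (a :: s) i <= t i <= nth b (a :: s) i.+1.

Definition mesh_lt (a b : R) (s : seq R) (delta : R) :=
  forall i, (i < size s)%N -> nth b (a :: s) i.+1 - nth b (a :: s) i < delta.

Definition increment E (a b : R) (s : seq R) (i : nat) : H -> H :=
  E (nth b (a :: s) i.+1) \- E (nth b (a :: s) i).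

(* Y is the Riemann-Stieltjes integral of f(s) dE_s over ]a, b], in the operator
   norm *)
Definition is_spectral_integral E (a b : R) f Y :=
  forall eps : R, 0 < eps -> exists2 delta : R, 0 < delta &
  forall s t, tagged_partition a b s t -> mesh_lt a b s delta -> forall x,
  `|\sum_(i < size s) (f (t i))%:C *: increment E a b s i x - Y x|
     <= eps%:C * `|x|.

(* Y is the Riemann-Stieltjes integral of phi(s, t) dE_s X dE_t over
   ]a, b] x ]a, b], in the operator norm. If
   phi(s, t) = \int alpha_w(s) beta_w(t) dnu(w) with alpha_w, beta_w continuous
   and \int |alpha_w|_oo |beta_w|_oo d|nu|(w) finite, as is the case for
   s f(t / s) with f operator monotone, then the limit exists and equals
   \int alpha_w(A) X beta_w(A) dnu(w), where A is the integral of s dE_s. *)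
Definition is_double_operator_integral E (a b : R) (phi : R -> R -> R) X Y :=
  forall eps : R, 0 < eps -> exists2 delta : R, 0 < delta &
  forall s t, tagged_partition a b s t -> mesh_lt a b s delta ->
  forall s' t', tagged_partition a b s' t' -> mesh_lt a b s' delta -> forall x,
  `|\sum_(i < size s) \sum_(j < size s') (phi (t i) (t' j))%:C *:
      increment E a b s i (X (increment E a b s' j x)) - Y x|
     <= eps%:C * `|x|.

(* E is carried by ]a, b] *)
Definition carried E (a b : R) := E a = \0 /\ E b = id.

(* the resolution of the identity of a bounded self-adjoint operator *)
Definition is_spectral_family A E :=
  [/\ forall s, orthogonal_projection (E s),
      forall s t, s <= t -> op_le (E s) (E t),
      forall s x, E u x @[u --> s^'+] --> E s x
    & exists a b, carried E a b /\ is_spectral_integral E a b id A].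

Definition spectral_family A : R -> H -> H := get (is_spectral_family A).

(* f(A) for A positive invertible. As E_a = 0 for some a > 0, only the values of
   f on ]0, +oo[ matter. *)
Definition op_fun f A : H -> H :=
  get [set Y | bounded_op Y /\ exists a b, [/\ 0 < a,
    carried (spectral_family A) a b
    & is_spectral_integral (spectral_family A) a b f Y]].

(* the double operator integral of phi(s, t) dE_s X dE_t, where E is the
   spectral family of a positive invertible A *)
Definition double_operator_integral A (phi : R -> R -> R) X : H -> H :=
  get [set Y | bounded_op Y /\ exists a b, [/\ 0 < a,
    carried (spectral_family A) a b
    & is_double_operator_integral (spectral_family A) a b phi X Y]].

Definition op_mean f A B : H -> H :=
  let C := op_sqrt A in
  C \o op_fun f (inverse C \o B \o inverse C) \o C.

Definition induced_aluthge f (T : H -> H) : H -> H :=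
  double_operator_integral (op_abs T) (fun s t => s * f (t / s))
    (polar_factor T).

Definition iterated_mean f (U P : H -> H) (n : nat) : H -> H :=
  iter n (fun M => op_mean f (adjoint U \o M \o U) M) P.

End SpectralIntegrals.

(* Functions on ]0, +oo[ are represented by functions on R of which only the
   restriction to ]0, +oo[ is constrained. Continuity is part of operator
   monotonicity, as f(A) is given by the continuous functional calculus. *)
Definition operator_monotone (R : realType) (f : R -> R) :=
  (forall x, 0 < x -> {for x, continuous f}) /\
  forall (H : hilbertType R) (A B : H -> H),
    pos_invertible A -> pos_invertible B -> op_le A B ->
    op_le (op_fun f A) (op_fun f B).

Definition representing_function (R : realType) (f : R -> R) :=
  [/\ forall x, 0 < x -> 0 < f x, operator_monotone f & f 1 = 1].

Definition weighted_arithmetic (R : realType) (f : R -> R) :=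
  exists lambda : R, 0 <= lambda <= 1 /\
    forall x, 0 < x -> f x = 1 - lambda + lambda * x.

(* Main.v *)
Require Import Defs.
From HB Require Import structures.
From mathcomp Require Import all_boot all_order all_algebra sesquilinear.
From mathcomp Require Import complex.
From mathcomp Require Import all_classical all_reals all_analysis.
From mathcomp Require Import ring lra.

(* By the spectral theorem for bounded self-adjoint operators, f(A) is the unique
   operator commuting with the spectral projections of A such that A x ~ c x
   implies f(A) x ~ f(c) x, uniformly for c in a compact subset of ]0, +oo[. Hence, without any commutation of A and B, A x ~ s x and B x ~ t x
   imply m_f(A, B) x ~ s f(t / s) x.

   Let T = U P, with E the spectral family of P. The double operator integral is
   a limit of sums over dE_s U dE_t = U (U^* dE_s U) dE_t. If U^* P U and P
   commute, so do the projections U^* E_s U and E_t, whose joint ranges consist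
   of approximate eigenvectors of U^* P U and P; thus the integral of
   s f(t / s) is U m_f(U^* P U, P). If f is affine, the sum splits and the same
   formula holds without commutation. Both parts follow by induction, since for
   a centered T the mean m_f(U^* P U, P) commutes with whatever commutes with
   all the U^{*k} P U^k and U^k P U^{*k}, so that U m_f(U^* P U, P) is centered. *)

Set Implicit Arguments.
Unset Strict Implicit.
Unset Printing Implicit Defensive.

Import Order.TTheory GRing.Theory Num.Theory numFieldNormedType.Exports.

Local Open Scope classical_set_scope.
Local Open Scope ring_scope.
Local Open Scope complex_scope.

(** The objects of the statement ([adjoint], [op_sqrt], [spectral_family], [op_fun],
    [double_operator_integral], [polar_factor]) are picked by [get]: each yields its defining
    property only once existence is shown, and can be identified only by a uniqueness argument. For
    integrals the carrying interval belongs to the choice, so candidates are shown to work on every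
    admissible interval. Algebraic rules for the functional calculus are replaced by estimates on
    approximate eigenvectors, which pass through products, inverses and substitution, and ask for no
    commutation. Test vectors are the ranges of the increments of E, where A differs from a tag by
    at most the mesh; since these ranges are orthogonal, bounds on them add up to an operator norm
    bound without loss. The double operator integral is obtained in each of the two cases by
    exhibiting its value, which gives existence and value together. *)

Lemma ReM (R : realType) (c d : R[i]) :
  complex.Re (c * d) = complex.Re c * complex.Re d - complex.Im c * complex.Im d.
Proof. by case: c d => a b [u v]. Qed.

(** * Hilbert space geometry *)

Section RealInnerProduct.
Context (R : realType) (H : hilbertType R).
Implicit Types (x y z : H) (r : R) (c : R[i]).

(** Working with real parts keeps all estimates in [R], within reach of [lra] and [nra]. Nothing is
    lost: the imaginary part of <x, y> is the real part of <x, i y>, see [innerE]. *)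
Definition ip x y : R := complex.Re (inner H x y).
Definition nrm x : R := complex.Re `|x|.

Lemma nrmE x : `|x| = (nrm x)%:C.
Proof. by rewrite /nrm RRe_real// ger0_real. Qed.

Lemma innerZl c x y : inner H (c *: x) y = c * inner H x y.
Proof. exact: linearZl_LR. Qed.

Lemma ipDl x y z : ip (x + y) z = ip x z + ip y z.
Proof. by rewrite /ip linearDl raddfD. Qed.

Lemma inner_conj x y : inner H x y = (inner H y x)^*.
Proof. by rewrite hermC expr0 mul1r. Qed.

Lemma ipC x y : ip x y = ip y x.
Proof. by rewrite /ip inner_conj; case: (inner H y x). Qed.

Lemma ipDr x y z : ip x (y + z) = ip x y + ip x z.
Proof. by rewrite ipC ipDl !(ipC x). Qed.

Lemma ipZl r x y : ip (r%:C *: x) y = r * ip x y.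
Proof. by rewrite /ip innerZl ReM /= mul0r subr0. Qed.

Lemma ipZr r x y : ip x (r%:C *: y) = r * ip x y.
Proof. by rewrite ipC ipZl ipC. Qed.

Lemma ipZcl c x y : ip (c *: x) y = ip x (conjc c *: y).
Proof.
rewrite /ip innerZl [inner H x (_ *: _)]inner_conj innerZl (inner_conj x y).
rewrite /=; case: c (inner H y x) => a b [u v] /=; rewrite ?ReM /=; lra.
Qed.

Lemma ipZcr c x y : ip x (c *: y) = ip (conjc c *: x) y.
Proof. by rewrite ipZcl conjcK. Qed.

Lemma innerE x y : inner H x y = ip x y +i* ip x ('i%C *: y).
Proof.
rewrite /ip [inner H x ('i *: _)]inner_conj innerZl (inner_conj x y).
case: (inner H y x) => a b /=; congr (_ +i* _). lra. Qed.

Lemma ip0l x : ip 0 x = 0.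
Proof. by apply: (addrI (ip 0 x)); rewrite -ipDl !addr0. Qed.

Lemma ip0r x : ip x 0 = 0.
Proof. by rewrite ipC ip0l. Qed.

Lemma ipNl x y : ip (- x) y = - ip x y.
Proof. by apply: (addrI (ip x y)); rewrite -ipDl !subrr ip0l. Qed.

Lemma ipNr x y : ip x (- y) = - ip x y.
Proof. by rewrite ipC ipNl ipC. Qed.

Lemma ipZil x y : ip ('i%C *: x) y = - ip x ('i%C *: y).
Proof.
rewrite ipZcl [conjc _](_ : _ = - 'i%C) ?scaleNr ?ipNr//.
by apply/eqP; rewrite eq_complex /= oppr0 !eqxx.
Qed.

Lemma ipBl x y z : ip (x - y) z = ip x z - ip y z.
Proof. by rewrite ipDl ipNl. Qed.

Lemma ipBr x y z : ip x (y - z) = ip x y - ip x z.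
Proof. by rewrite ipDr ipNr. Qed.

Lemma nrm_ge0 x : 0 <= nrm x.
Proof. rewrite -lecR -nrmE. exact: normr_ge0. Qed.

Lemma nrm2 x : nrm x ^+ 2 = ip x x.
Proof. by rewrite /ip -inner_norm nrmE -rmorphXn. Qed.

Lemma ip_ge0 x : 0 <= ip x x.
Proof. by rewrite -nrm2 sqr_ge0. Qed.

Lemma nrm0 : nrm 0 = 0.
Proof. by rewrite /nrm normr0. Qed.

Lemma nrm_eq0 x : nrm x = 0 -> x = 0.
Proof. by move=> h; apply/eqP; rewrite -normr_eq0 nrmE h. Qed.

Lemma ip_eq0 x : ip x x = 0 -> x = 0.
Proof. by rewrite -nrm2 => /eqP; rewrite sqrf_eq0 => /eqP/nrm_eq0. Qed.

Lemma nrmD x y : nrm (x + y) <= nrm x + nrm y.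
Proof. by have := ler_normD x y; rewrite !nrmE -rmorphD lecR. Qed.

Lemma nrmN x : nrm (- x) = nrm x.
Proof. by rewrite /nrm normrN. Qed.

Lemma nrmB x y : nrm (x - y) <= nrm x + nrm y.
Proof. by rewrite -(nrmN y) nrmD. Qed.

Lemma nrmC x y : nrm (x - y) = nrm (y - x).
Proof. by rewrite -nrmN opprB. Qed.

Lemma nrmZ r x : nrm (r%:C *: x) = `|r| * nrm x.
Proof.
have := normrZ r%:C x; rewrite !nrmE normc_def /= expr0n addr0 sqrtr_sqr -rmorphM.
by move/complexI.
Qed.

Lemma nrm_le0 x : nrm x <= 0 -> x = 0.
Proof. by move=> h; apply: nrm_eq0; apply/eqP; rewrite eq_le h nrm_ge0. Qed.

Lemma ler_nrm x y r : (`|x| <= r%:C * `|y|) = (nrm x <= r * nrm y).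
Proof. by rewrite !nrmE -rmorphM lecR. Qed.

(** Cauchy-Schwarz, from the square of |y| x - |x| y, which avoids a quotient. *)
Lemma ip_le_nrm x y : ip x y <= nrm x * nrm y.
Proof.
have [/nrm_le0->|x0] := leP (nrm x) 0; first by rewrite ip0l nrm0 mul0r.
have := ip_ge0 ((nrm y)%:C *: x - (nrm x)%:C *: y).
rewrite ipBl !ipBr !ipZl !ipZr -!nrm2 (ipC y) => h.
have [/nrm_le0->|y0] := leP (nrm y) 0; first by rewrite ip0r nrm0 mulr0.
have : 0 <= 2 * (nrm x * nrm y) * (nrm x * nrm y - ip x y) by nra.
by rewrite pmulr_rge0 ?subr_ge0 // !mulr_gt0.
Qed.

Lemma norm_ip_le x y : `|ip x y| <= nrm x * nrm y.
Proof. by rewrite ler_norml ip_le_nrm andbT lerNl -ipNl -(nrmN x) ip_le_nrm. Qed.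

Lemma nrm2D x y : nrm (x + y) ^+ 2 = nrm x ^+ 2 + 2 * ip x y + nrm y ^+ 2.
Proof. rewrite !nrm2 ipDl !ipDr (ipC y x); lra. Qed.

Lemma nrm2B x y : nrm (x - y) ^+ 2 = nrm x ^+ 2 - 2 * ip x y + nrm y ^+ 2.
Proof. rewrite nrm2D ipNr nrmN; lra. Qed.

Lemma ip_ext x y : (forall z, ip z x = ip z y) -> x = y.
Proof.
move=> h; apply/eqP; rewrite -subr_eq0; apply/eqP/ip_eq0.
by rewrite ipBr h subrr.
Qed.

Lemma ler_nrm2 x r : 0 <= r -> ip x x <= r ^+ 2 -> nrm x <= r.
Proof. by move=> r0; rewrite -nrm2 ler_pXn2r// nnegrE nrm_ge0. Qed.

Lemma ip_suml (I : finType) (F : I -> H) y : ip (\sum_i F i) y = \sum_i ip (F i) y.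
Proof.
by apply: (big_ind2 (fun u v => ip u y = v)) => [|a b c d <- <-|//]; rewrite ?ip0l ?ipDl.
Qed.

Lemma ip_sumr (I : finType) (F : I -> H) y : ip y (\sum_i F i) = \sum_i ip y (F i).
Proof. by rewrite ipC ip_suml; apply: eq_bigr => i _; rewrite ipC. Qed.

Definition nlim (u : nat -> H) l :=
  forall e : R, 0 < e -> exists N, forall n, (N <= n)%N -> nrm (u n - l) <= e.

Lemma nrm_cauchy (u : nat -> H) :
  (forall e : R, 0 < e -> exists N, forall m n, (N <= m)%N -> (N <= n)%N ->
     nrm (u m - u n) <= e) ->
  exists l, nlim u l.
Proof.
move=> hu.
have cu : cauchy (u @ \oo).
  apply/cauchy_ballP => e e0.
  have [re e_re] : exists re, e = re%:C by apply/complex_realP; rewrite gtr0_real.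
  move: e0; rewrite e_re ltcR => re0.
  have [N hN] := hu (re / 2) (divr_gt0 re0 (ltr0n _ 2)).
  exists ((u @` [set n | (N <= n)%N]), (u @` [set n | (N <= n)%N])).
    by split; exists N => // n /= Nn; exists n.
  move=> [_ _] [[m /= Nm <-] [n /= Nn <-]].
  rewrite -ball_normE /ball_ /= nrmE ltcR.
  by apply: le_lt_trans (hN _ _ Nm Nn) _; lra.
have /cvg_ex [l ul] : cvg (u @ \oo) by exact: cauchy_cvg.
exists l => e e0.
have e0' : 0 < e%:C by rewrite ltcR.
have [N _ hN] := @cvgr_dist_lt _ _ _ _ _ _ _ ul _ e0'.
exists N => n Nn; have := hN n Nn; rewrite nrmE ltcR nrmC; exact: ltW.
Qed.

End RealInnerProduct.

(** * Bounded operators and limits in operator norm *)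

Section BoundedOperatorTheory.
Context (R : realType) (H : hilbertType R).
Implicit Types (A B C S T Z : H -> H) (x y z : H).

Lemma bounded_opP A : bounded_op A <->
  linear A /\ exists2 k : R, 0 < k & forall x, nrm (A x) <= k * nrm x.
Proof.
split=> -[lA].
  pose f : {linear H -> H} := HB.pack A (GRing.isLinear.Build _ _ _ _ A lA).
  move=> cA; split=> //.
  have /linear_boundedP/pinfty_ex_gt0 [r r0 hr] : bounded_near f (nbhs (0 : H)).
    by apply: continuous_linear_bounded; exact: cA.
  have [k kr] : exists k, r = k%:C by apply/complex_realP; rewrite gtr0_real.
  by exists k => [|x]; [rewrite -ltcR -kr|rewrite -ler_nrm -kr; exact: hr].
move=> [k k0 hk]; split=> //.
pose f : {linear H -> H} := HB.pack A (GRing.isLinear.Build _ _ _ _ A lA).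
apply: (@bounded_linear_continuous _ _ _ f); apply/linear_boundedP.
exists k%:C; split; first by rewrite gtr0_real// ltcR.
by move=> r /ltW kr x; apply: le_trans (ler_wpM2r _ kr); rewrite ?ler_nrm.
Qed.

Section Linearity.
Variables (A : H -> H) (hA : bounded_op A).

Lemma bopD x y : A (x + y) = A x + A y.
Proof. by have := hA.1 1 x y; rewrite !scale1r. Qed.

Lemma bop0 : A 0 = 0.
Proof. by apply: (addrI (A 0)); rewrite -bopD !addr0. Qed.

Lemma bopZ (c : R[i]) x : A (c *: x) = c *: A x.
Proof. by have := hA.1 c x 0; rewrite !addr0 bop0 addr0. Qed.

Lemma bopN x : A (- x) = - A x.
Proof. by rewrite -scaleN1r bopZ scaleN1r. Qed.

Lemma bopB x y : A (x - y) = A x - A y.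
Proof. by rewrite bopD bopN. Qed.

Lemma bop_sum (I : finType) (F : I -> H) : A (\sum_i F i) = \sum_i A (F i).
Proof. exact: (big_morph _ bopD bop0). Qed.

Lemma bop_bound : exists2 k : R, 0 < k & forall x, nrm (A x) <= k * nrm x.
Proof. by have /bounded_opP[] := hA. Qed.

End Linearity.

Lemma bounded_op_id : bounded_op (@id H).
Proof. by apply/bounded_opP; split=> //; exists 1 => // x; rewrite mul1r. Qed.

Lemma bounded_op_comp A B : bounded_op A -> bounded_op B -> bounded_op (A \o B).
Proof.
move=> hA hB; apply/bounded_opP; split; first by move=> c x y /=; rewrite hB.1 hA.1.
have [k k0 hk] := bop_bound hA; have [l l0 hl] := bop_bound hB.
exists (k * l) => [|x]; first exact: mulr_gt0.
by rewrite -mulrA; apply: le_trans (hk _) _; rewrite ler_pM2l.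
Qed.

Lemma bounded_opD A B : bounded_op A -> bounded_op B -> bounded_op (A \+ B).
Proof.
move=> hA hB; apply/bounded_opP; split.
  by move=> c x y /=; rewrite hB.1 hA.1 scalerDr addrACA.
have [k k0 hk] := bop_bound hA; have [l l0 hl] := bop_bound hB.
exists (k + l) => [|x]; first exact: addr_gt0.
by rewrite mulrDl; apply: le_trans (nrmD _ _) _; rewrite lerD.
Qed.

Lemma bounded_op_scale (c : R[i]) : bounded_op (fun x : H => c *: x).
Proof.
split; last exact: scaler_continuous.
by move=> a x y; rewrite scalerDr !scalerA mulrC.
Qed.

Lemma bounded_opZ c A : bounded_op A -> bounded_op (fun x => c *: A x).
Proof. by move=> hA; exact: (bounded_op_comp (bounded_op_scale c) hA). Qed.

Lemma bounded_opB A B : bounded_op A -> bounded_op B -> bounded_op (A \- B).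
Proof.
move=> hA hB; have := bounded_opD hA (bounded_opZ (-1) hB).
by congr bounded_op; apply/funext => x /=; rewrite scaleN1r.
Qed.

Lemma bounded_op0 : bounded_op (\0 : H -> H).
Proof.
have := bounded_opZ 0 bounded_op_id.
by congr bounded_op; apply/funext => x /=; rewrite scale0r.
Qed.

Lemma bounded_op_sum (I : finType) (F : I -> H -> H) :
  (forall i, bounded_op (F i)) -> bounded_op (fun x => \sum_i F i x).
Proof.
move=> hF; rewrite -fct_sumE; apply: big_ind => [|A B|i _]; first exact: bounded_op0.
  exact: bounded_opD.
exact: hF.
Qed.

Lemma is_adjoint_ip A S : bounded_op A -> bounded_op S ->
  is_adjoint A S <-> forall x y, ip (A x) y = ip x (S y).
Proof.
move=> hA hS; split=> h x y; first by rewrite /ip h.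
by rewrite !innerE !h (bopZ hS).
Qed.

(** Convergence in operator norm, phrased through the bounds [e * nrm x] so that no operator norm
    has to be defined. *)
Definition oplim (Y : nat -> H -> H) L := forall e : R, 0 < e ->
  exists N, forall n, (N <= n)%N -> forall x, nrm (Y n x - L x) <= e * nrm x.

Lemma oplim_nlim Y L : oplim Y L -> forall x, nlim (Y ^~ x) (L x).
Proof.
move=> h x e e0; have x1 : 0 < nrm x + 1 by rewrite ltr_wpDl ?nrm_ge0.
have [N hN] := h (e / (nrm x + 1)) (divr_gt0 e0 x1).
exists N => n /hN /(_ x) /le_trans; apply.
rewrite mulrAC ler_pdivrMr// ler_pM2l//; lra.
Qed.

Lemma nlim_const_le (u : nat -> H) l y (r : R) :
  nlim u l -> (exists N, forall n, (N <= n)%N -> nrm (u n - y) <= r) -> nrm (l - y) <= r.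
Proof.
move=> ul [N hN]; apply/ler_addgt0Pr => e e0; have [M hM] := ul e e0.
have := nrmD (l - u (maxn N M)) (u (maxn N M) - y).
rewrite addrA subrK => /le_trans; apply; rewrite [leRHS]addrC.
by apply: lerD; [rewrite nrmC; apply: hM; rewrite leq_maxr|apply: hN; rewrite leq_maxl].
Qed.

Lemma nlim_unique (u : nat -> H) l l' : nlim u l -> nlim u l' -> l = l'.
Proof.
move=> ul ul'; apply/eqP; rewrite -subr_eq0; apply/eqP/nrm_le0/ler_addgt0Pr => e e0.
by rewrite add0r; apply: nlim_const_le ul _; exact: ul'.
Qed.

Lemma nlim_bop A (u : nat -> H) l : bounded_op A -> nlim u l -> nlim (A \o u) (A l).
Proof.
move=> hA ul e e0; have [k k0 hk] := bop_bound hA.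
have [N hN] := ul (e / k) (divr_gt0 e0 k0); exists N => n Nn /=.
by rewrite -bopB//; apply: le_trans (hk _) _; rewrite mulrC -ler_pdivlMr// hN.
Qed.

Lemma nlimD (u v : nat -> H) l m : nlim u l -> nlim v m -> nlim (fun n => u n + v n) (l + m).
Proof.
move=> ul vm e e0; have [N hN] := ul (e / 2) (divr_gt0 e0 (ltr0n _ 2)).
have [M hM] := vm (e / 2) (divr_gt0 e0 (ltr0n _ 2)).
exists (maxn N M) => n; rewrite geq_max => /andP[/hN uN /hM vN].
by rewrite opprD addrACA; apply: le_trans (nrmD _ _) _; lra.
Qed.

Lemma oplim_ip (Y : nat -> H -> H) L x y (e : R) : 0 < e -> oplim Y L ->
  exists N, forall n, (N <= n)%N -> `|ip (Y n x) y - ip (L x) y| <= e.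
Proof.
move=> e0 YL; have p0 : 0 < nrm x * nrm y + 1 by rewrite ltr_wpDl// mulr_ge0// nrm_ge0.
have [N hN] := YL _ (divr_gt0 e0 p0); exists N => n /hN /(_ x) h.
rewrite -ipBl; apply: le_trans (norm_ip_le _ _) _.
apply: le_trans (ler_wpM2r (nrm_ge0 y) h) _.
rewrite -mulrA mulrAC ler_pdivrMr// ler_pM2l//; lra.
Qed.

Lemma oplim_exists (Y : nat -> H -> H) : (forall n, bounded_op (Y n)) ->
  (forall e : R, 0 < e -> exists N, forall m n, (N <= m)%N -> (N <= n)%N ->
     forall x, nrm (Y m x - Y n x) <= e * nrm x) ->
  exists2 L, bounded_op L & oplim Y L.
Proof.
move=> hY cY.
have ex x : exists l, nlim (Y ^~ x) l.
  apply: nrm_cauchy => e e0; have x1 : 0 < nrm x + 1 by rewrite ltr_wpDl ?nrm_ge0.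
  have [N hN] := cY (e / (nrm x + 1)) (divr_gt0 e0 x1).
  exists N => m n Nm Nn; apply: le_trans (hN m n Nm Nn x) _.
  rewrite mulrAC ler_pdivrMr// ler_pM2l//; lra.
have [L hL] := choice ex.
have lL : oplim Y L.
  move=> e e0; have [N hN] := cY e e0; exists N => n Nn x.
  rewrite nrmC; apply: nlim_const_le (hL x) _; exists N => m Nm; exact: hN.
exists L => //; apply/bounded_opP; split.
  move=> c x y; apply: nlim_unique (hL _) _.
  have := nlimD (nlim_bop (bounded_op_scale c) (hL x)) (hL y).
  by congr nlim; apply/funext => n /=; rewrite (hY n).1.
have [N hN] := lL 1 ltr01; have [k k0 hk] := bop_bound (hY N).
exists (k + 1) => [|x]; first exact: addr_gt0.
rewrite -[L x](subrK (Y N x)) mulrDl mul1r addrC -(opprB (Y N x)).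
apply: le_trans (nrmB _ _) _; apply: lerD => //.
by have := hN N (leqnn _) x; rewrite mul1r.
Qed.

Definition opcomm A B := forall x, A (B x) = B (A x).

Lemma oplim_comm (Y : nat -> H -> H) L Z : bounded_op Z -> oplim Y L ->
  (forall n, opcomm Z (Y n)) -> opcomm Z L.
Proof.
move=> hZ YL cY x; apply: nlim_unique (nlim_bop hZ (oplim_nlim YL x)) _.
by have := oplim_nlim YL (Z x); congr nlim; apply/funext => n; rewrite /= cY.
Qed.

Definition sa A := bounded_op A /\ forall x y, ip (A x) y = ip x (A y).

Lemma oplim_sa (Y : nat -> H -> H) L : bounded_op L -> oplim Y L ->
  (forall n, sa (Y n)) -> sa L.
Proof.
move=> bL YL hY; split=> // x y.
apply/eqP; rewrite -subr_eq0 -normr_le0; apply/ler_addgt0Pr => e e0; rewrite add0r.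
have e20 : 0 < e / 2 by rewrite divr_gt0.
have [N hN] := oplim_ip x y e20 YL; have [M hM] := oplim_ip y x e20 YL.
have := hN _ (leq_maxl N M); have := hM _ (leq_maxr N M).
rewrite (hY _).2 (ipC y) (ipC x (L y)) !ler_norml.
by move=> /andP[h1 h2] /andP[h3 h4]; apply/andP; split; lra.
Qed.

End BoundedOperatorTheory.

Lemma invSn_le (R : realType) (e : R) : 0 < e ->
  exists N, forall n, (N <= n)%N -> n.+1%:R^-1 <= e.
Proof.
move=> e0; exists (Num.bound e^-1) => n hn.
rewrite invf_ple ?posrE//; apply: le_trans (ltW (archi_boundP _)) _.
  by rewrite invr_ge0 ltW.
by rewrite ler_nat (leq_trans hn).
Qed.

(** * Projection theorem and existence of adjoints *)

Section ProjectionTheorem.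
Context (R : realType) (H : hilbertType R).
Implicit Types (A B C S T Z : H -> H) (x y z : H).

(** Only real scalars and real orthogonality occur, because the Riesz argument of [adjoint_exists]
    projects onto a real hyperplane, which is in general not a complex subspace. *)
Lemma projection_theorem (V : set H) : V 0 ->
  (forall x y, V x -> V y -> V (x + y)) ->
  (forall (r : R) x, V x -> V (r%:C *: x)) ->
  (forall u l, (forall n : nat, V (u n)) -> nlim u l -> V l) ->
  forall x, exists2 v, V v & forall w, V w -> ip (x - v) w = 0.
Proof.
move=> V0 VD VZ Vcl x.
pose D := [set nrm (x - w) | w in V].
have D0 : D !=set0 by exists (nrm (x - 0)), 0.
have Dlb : has_lbound D by exists 0 => _ [w _ <-]; exact: nrm_ge0.
have dle w : V w -> inf D <= nrm (x - w) by move=> Vw; apply: ge_inf => //; exists w.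
have d0 : 0 <= inf D by apply: lb_le_inf => // _ [w _ <-]; exact: nrm_ge0.
have VN w : V w -> V (- w).
  by move=> Vw; rewrite -scaleN1r -(rmorphN1 (real_complex R)); exact: VZ.
set d := inf D in dle d0.
have ex (n : nat) : exists w, V w /\ nrm (x - w) <= d + n.+1%:R^-1.
  have n0 : 0 < n.+1%:R^-1 :> R by rewrite invr_gt0.
  have [_ [w Vw <-] hw] := inf_adherent n0 (conj D0 Dlb).
  by exists w; split=> //; exact: ltW.
have [u hu] := choice ex.
have [v hv] : exists v, nlim u v.
  apply: nrm_cauchy => e e0.
  (* By the parallelogram law the squared distance is at most 4 (d + eta)^2 - 4 d^2, hence at most 4
     eta (2 d + 1) as eta <= 1. *)
  pose eta := Num.min 1 (e ^+ 2 / (4 * (2 * d + 1))).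
  have p0 : 0 < 4 * (2 * d + 1) by lra.
  have eta0 : 0 < eta by rewrite lt_min ltr01 divr_gt0 ?exprn_gt0.
  have [N hN] := invSn_le eta0; exists N => m n Nm Nn.
  have eta1 : eta <= 1 by rewrite ge_min lexx.
  have eta2 : eta * (4 * (2 * d + 1)) <= e ^+ 2 by rewrite -ler_pdivlMr// ge_min lexx orbT.
  have am : nrm (x - u m) <= d + eta by apply: le_trans (hu m).2 _; rewrite lerD2l hN.
  have an : nrm (x - u n) <= d + eta by apply: le_trans (hu n).2 _; rewrite lerD2l hN.
  have hmid : d <= nrm (x - (2^-1)%:C *: (u m + u n)).
    by apply: dle; apply/VZ/VD; [exact: (hu m).1|exact: (hu n).1].
  apply: ler_nrm2; first exact: ltW.
  have -> : ip (u m - u n) (u m - u n) = 2 * nrm (x - u m) ^+ 2 + 2 * nrm (x - u n) ^+ 2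
     - 4 * nrm (x - (2^-1)%:C *: (u m + u n)) ^+ 2.
    rewrite !nrm2 !(ipBl, ipBr) !ipZl !ipZr !(ipDl, ipDr).
    by rewrite (ipC (u m) x) (ipC (u n) x) (ipC (u n) (u m)); field.
  have := nrm_ge0 (x - u m); have := nrm_ge0 (x - u n).
  move: am an hmid; set a := nrm (x - u m); set b := nrm (x - u n); set c := nrm _.
  move=> am an hmid a0 b0; nra.
exists v; first by apply: Vcl hv => n; exact: (hu n).1.
have vd : nrm (x - v) <= d.
  apply/ler_addgt0Pr => e e0; have e20 : 0 < e / 2 by rewrite divr_gt0.
  have [N hN] := hv _ e20; have [M hM] := invSn_le e20.
  have h1 := hN _ (leq_maxl N M).
  have h2 : nrm (x - u (maxn N M)) <= d + e / 2.
    by apply: le_trans (hu _).2 _; rewrite lerD2l hM ?leq_maxr.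
  have := nrmD (x - u (maxn N M)) (u (maxn N M) - v); rewrite addrA subrK => h3; lra.
move=> w Vw; have [->|w0] := eqVneq w 0; first by rewrite ip0r.
have ww : 0 < ip w w.
  by rewrite lt_neqAle ip_ge0 andbT eq_sym; apply: contra_neq w0 => /ip_eq0.
(* Moving v by t w, the best step along w, lowers the squared distance by t^2 <w, w>; minimality of
   v forces t = 0. *)
pose t := ip (x - v) w / ip w w.
have := dle (v + t%:C *: w) (VD _ _ (Vcl _ _ (fun n => (hu n).1) hv) (VZ _ _ Vw)).
rewrite opprD addrA => h.
have : nrm (x - v) ^+ 2 <= nrm (x - v - t%:C *: w) ^+ 2.
  by rewrite ler_pXn2r// ?nnegrE ?nrm_ge0//; exact: le_trans vd h.
rewrite [leRHS]nrm2B [nrm (t%:C *: w) ^+ 2]nrm2 !ipZr ipZl.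
have -> : ip (x - v) w = t * ip w w by rewrite divfK// gt_eqF.
move=> h2; have t0 : t = 0.
  apply/eqP; rewrite -sqrf_eq0 eq_le sqr_ge0 andbT -(pmulr_lle0 _ ww); nra.
by rewrite t0 mul0r.
Qed.

(** The Riesz vector is found for the real functional x -> Re <A x, y>; complex linearity of S then
    comes from that of A through [ipZcr]. *)
Lemma adjoint_exists A : bounded_op A -> exists2 S, bounded_op S & is_adjoint A S.
Proof.
move=> hA; have [k k0 hk] := bop_bound hA.
have riesz y : exists z, forall x, ip (A x) y = ip x z.
  have [h|/existsNP[x0 hx0]] := pselect (forall x, ip (A x) y = 0).
    by exists 0 => x; rewrite ip0r.
  pose V : set H := [set x | ip (A x) y = 0].
  have [] := @projection_theorem V _ _ _ _ x0; rewrite /V /=.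
  - by rewrite bop0// ip0l.
  - by move=> x x' h h'; rewrite bopD// ipDl h h' addr0.
  - by move=> r x h; rewrite bopZ// ipZl h mulr0.
  - move=> u l hu ul; apply/eqP; rewrite -normr_le0; apply/ler_addgt0Pr => e e0.
    have p0 : 0 < k * (nrm y + 1) by rewrite mulr_gt0// ltr_wpDl ?nrm_ge0.
    have [N hN] := ul _ (divr_gt0 e0 p0).
    rewrite add0r -[ip _ _]subr0 -[X in _ - X](hu N) -ipBl -bopB//.
    apply: le_trans (norm_ip_le _ _) _.
    have := hN N (leqnn _); rewrite ler_pdivlMr// nrmC => h.
    apply: le_trans (ler_wpM2r (nrm_ge0 y) (hk _)) _.
    by apply: le_trans h; have := nrm_ge0 (l - u N); have := nrm_ge0 y; nra.
  move=> v hv orth; pose w := x0 - v.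
  have Aw : ip (A w) y = ip (A x0) y by rewrite bopB// ipBl hv subr0.
  have ww : ip w w != 0 by apply/eqP => /ip_eq0 w0; apply: hx0; rewrite -Aw w0 bop0// ip0l.
  (* w spans the real orthogonal complement of the kernel, and the scalar is fixed by the value of
     the functional at w. *)
  exists ((ip (A w) y / ip w w)%:C *: w) => x; rewrite ipZr.
  have Aw0 : ip (A w) y != 0 by rewrite Aw; apply/eqP.
  have := orth (x - (ip (A x) y / ip (A w) y)%:C *: w).
  rewrite bopB// bopZ// ipBl ipZl divfK// subrr => /(_ erefl).
  rewrite -/w ipBr ipZr (ipC w x) => /eqP; rewrite subr_eq0 => /eqP ->.
  by field; rewrite ?ww ?Aw0.
have [S hS] := choice riesz.
have bS : bounded_op S.
  apply/bounded_opP; split.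
    move=> c x y; apply: ip_ext => z; rewrite ipDr -!hS ipDr; congr (_ + _).
    by rewrite [RHS]ipZcr -hS bopZ// -ipZcr.
  exists k => // x; have [/nrm_le0->|Sx] := leP (nrm (S x)) 0.
    by rewrite nrm0; apply: mulr_ge0; [exact: ltW|exact: nrm_ge0].
  rewrite -(ler_pM2l Sx) -expr2 nrm2 -hS; apply: le_trans (ip_le_nrm _ _) _.
  by rewrite mulrA [nrm (S x) * k]mulrC ler_wpM2r ?nrm_ge0.
by exists S => //; exact/is_adjoint_ip.
Qed.

End ProjectionTheorem.

(** * Self-adjoint operators and square roots *)

Section SelfAdjoint.
Context (R : realType) (H : hilbertType R).
Implicit Types (A B C S T Z : H -> H) (x y z : H).

Lemma sa_id : sa (@id H).
Proof. by split=> //; exact: bounded_op_id. Qed.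

Lemma sa0 : sa (\0 : H -> H).
Proof. by split=> [|x y]; [exact: bounded_op0|rewrite ip0l ip0r]. Qed.

Lemma saD A B : sa A -> sa B -> sa (A \+ B).
Proof.
move=> [bA hA] [bB hB]; split=> [|x y /=]; first exact: bounded_opD.
by rewrite ipDl ipDr hA hB.
Qed.

Lemma saB A B : sa A -> sa B -> sa (A \- B).
Proof.
move=> [bA hA] [bB hB]; split=> [|x y /=]; first exact: bounded_opB.
by rewrite ipBl ipBr hA hB.
Qed.

Lemma saZ (r : R) A : sa A -> sa (fun x => r%:C *: A x).
Proof.
move=> [bA hA]; split=> [|x y /=]; first exact: bounded_opZ.
by rewrite ipZl ipZr hA.
Qed.

Lemma sa_scalar (r : R) : sa (fun x : H => r%:C *: x).
Proof. exact: saZ sa_id. Qed.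

Lemma sa_comp A B : sa A -> sa B -> opcomm A B -> sa (A \o B).
Proof.
move=> [bA hA] [bB hB] AB; split=> [|x y /=]; first exact: bounded_op_comp.
by rewrite hA hB AB.
Qed.

Lemma sa_sum (I : finType) (F : I -> H -> H) :
  (forall i, sa (F i)) -> sa (fun x => \sum_i F i x).
Proof.
move=> hF; split=> [|x y]; first by apply: bounded_op_sum => i; exact: (hF i).1.
by rewrite ip_suml ip_sumr; apply: eq_bigr => i _; rewrite (hF i).2.
Qed.

Lemma sa_conj A B : sa A -> sa B -> sa (B \o A \o B).
Proof.
move=> [bA hA] [bB hB]; split=> [|x y /=].
  by apply: bounded_op_comp => //; exact: bounded_op_comp.
by rewrite hB hA hB.
Qed.

Lemma sa_adjoint A : sa A -> is_adjoint A A.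
Proof. by move=> [bA hA]; apply/is_adjoint_ip. Qed.

(** Since <A x, x> is real, Re <A x, i x> vanishes for all x; polarizing this at x + i y gives the
    symmetry of A. *)
Lemma positive_opP A : positive_op A <-> sa A /\ forall x, 0 <= ip (A x) x.
Proof.
split=> [[bA hA]|[[bA hA] pA]].
  have im x : ip (A x) ('i%C *: x) = 0.
    by have := hA x; rewrite innerE lecE /= => /andP[/eqP].
  split; last by move=> x; have := hA x; rewrite innerE lecE /= => /andP[].
  split=> // x y.
  have ii u : 'i%C *: ('i%C *: u) = - u :> H.
    by rewrite scalerA [_ * _](_ : _ = -1) ?scaleN1r// -expr2 sqr_i.
  have := im (x + 'i%C *: y).
  rewrite scalerDr (bopD bA) (bopZ bA) !ipDl !ipDr !ipZil !ii !scalerN !ipNr !im (ipC x).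
  by lra.
split=> // x; rewrite innerE lecE /= pA andbT; apply/eqP.
by have := ipZil (A x) x; rewrite -(bopZ bA) hA ipC; lra.
Qed.

Lemma positive_sa A : positive_op A -> sa A.
Proof. by case/positive_opP. Qed.

Lemma positive_ip A x : positive_op A -> 0 <= ip (A x) x.
Proof. by case/positive_opP. Qed.

(** Positivity tested at k x - A x. It stands for A^2 <= k A and is available before square roots
    are. *)
Lemma positive_norm2 A (k : R) : positive_op A -> 0 < k ->
  (forall x, nrm (A x) <= k * nrm x) -> forall x, nrm (A x) ^+ 2 <= k * ip (A x) x.
Proof.
move=> /positive_opP[[bA hA] pA] k0 hk x.
have := pA (k%:C *: x - A x).
rewrite bopB// bopZ// !(ipBl, ipBr) !ipZl !ipZr (hA (A x) x) -nrm2 => h.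
have h2 : ip (A (A x)) (A x) <= k * nrm (A x) ^+ 2.
  apply: le_trans (ip_le_nrm _ _) _; rewrite expr2 mulrA.
  by apply: ler_wpM2r => //; exact: nrm_ge0.
have : 0 <= k * (k * ip (A x) x - nrm (A x) ^+ 2) by lra.
by rewrite pmulr_rge0// subr_ge0.
Qed.

(** The forms at x + y and x - y differ by 4 <C x, y>; take for y the vector C x rescaled to the
    length of x and apply the parallelogram law. *)
Lemma sa_norm C (d : R) : sa C -> 0 <= d ->
  (forall x, `|ip (C x) x| <= d * nrm x ^+ 2) -> forall x, nrm (C x) <= d * nrm x.
Proof.
move=> [bC hC] d0 h x.
have [/nrm_le0->|Cx0] := leP (nrm (C x)) 0; first by rewrite nrm0 mulr_ge0 ?nrm_ge0.
have [/nrm_le0 x0|x0] := leP (nrm x) 0; first by move: Cx0; rewrite x0 bop0// nrm0 ltxx.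
pose y := (nrm x / nrm (C x))%:C *: C x.
have ny : nrm y = nrm x by rewrite nrmZ ger0_norm ?divfK ?gt_eqF// divr_ge0 ?nrm_ge0.
have := h (x + y); have := h (x - y).
rewrite nrm2B nrm2D ny bopB// bopD// !(ipBl, ipBr, ipDl, ipDr) !ipNr.
have -> : ip (C y) x = ip (C x) y by rewrite hC ipC.
have -> : ip (C x) y = nrm x * nrm (C x).
  by rewrite ipZr -nrm2; field; rewrite gt_eqF.
rewrite !ler_norml => /andP[h1 h2] /andP[h3 h4].
by rewrite -(ler_pM2l x0); nra.
Qed.

(** Seek S = 1 - L: then S^2 = 1 - B amounts to L = (B + L^2) / 2, solved by iteration from 0. The
    scalar sequence [y] is the same iteration with B replaced by 1; it increases, stays below 1, and
    majorizes both the iterates and their increments. *)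
Lemma sqrt_contraction B : sa B -> (forall x, nrm (B x) <= nrm x) ->
  exists S, [/\ sa S, forall x, 0 <= ip (S x) x, forall x, S (S x) = x - B x
    & forall Z, bounded_op Z -> opcomm Z B -> opcomm Z S].
Proof.
move=> sB hB; have bB := sB.1.
pose Y n := iter n (fun (T : H -> H) x => (2^-1)%:C *: (B x + T (T x))) (\0 : H -> H).
pose y n := iter n (fun t : R => (1 + t ^+ 2) / 2) 0.
have YS n x : Y n.+1 x = (2^-1)%:C *: (B x + Y n (Y n x)) by [].
have yS n : y n.+1 = (1 + y n ^+ 2) / 2 by [].
have y01 n : 0 <= y n <= 1.
  by elim: n => [|n /andP[h1 h2]]; rewrite ?lexx ?ler01// yS; apply/andP; split; nra.
have yle n : y n <= y n.+1 by rewrite yS; have := y01 n; nra.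
have saY n : sa (Y n).
  elim: n => [|n ih]; first exact: sa0.
  by apply: saZ; apply: saD => //; apply: sa_comp.
have Yn n x : nrm (Y n x) <= y n * nrm x.
  elim: n x => [|n ih] x; first by rewrite nrm0 mul0r.
  have /andP[y0 _] := y01 n.
  have h1 : nrm (Y n (Y n x)) <= y n * (y n * nrm x).
    by apply: le_trans (ih _) _; rewrite ler_wpM2l.
  rewrite YS nrmZ ger0_norm// yS; have := nrmD (B x) (Y n (Y n x)); have := hB x.
  by move=> h2 h3; nra.
(* A difference of squares is split as Y' (Y' - Y) + (Y' - Y) Y, whose bound is the corresponding
   difference of squares for [y]. *)
have dY n x : nrm (Y n.+1 x - Y n x) <= (y n.+1 - y n) * nrm x.
  elim: n x => [|n ih] x; first by rewrite subr0 (_ : y 0 = 0)// subr0; exact: (Yn 1%N).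
  rewrite (YS n.+1) [in X in _ - X]YS -scalerBr nrmZ ger0_norm// opprD addrACA subrr add0r.
  have -> : Y n.+1 (Y n.+1 x) - Y n (Y n x) =
      Y n.+1 (Y n.+1 x - Y n x) + (Y n.+1 (Y n x) - Y n (Y n x)).
    by rewrite (bopB (saY _).1) addrA subrK.
  have := nrmD (Y n.+1 (Y n.+1 x - Y n x)) (Y n.+1 (Y n x) - Y n (Y n x)).
  have /andP[y0 _] := y01 n; have /andP[y1 _] := y01 n.+1.
  have := ih x; have := ih (Y n x); have := Yn n x; have := Yn n.+1 (Y n.+1 x - Y n x).
  move=> h1 h2 h3 h4 h5; have -> : y n.+2 - y n.+1 = (y n.+1 - y n) * (y n.+1 + y n) / 2.
    by rewrite (yS n.+1) [in X in _ - X = _]yS; field.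
  have d0 : 0 <= y n.+1 - y n by rewrite subr_ge0.
  have e1 := ler_wpM2l y1 h4; have e2 := ler_wpM2l d0 h2.
  by lra.
have dYm m n x : nrm (Y (n + m)%N x - Y n x) <= (y (n + m)%N - y n) * nrm x.
  elim: m => [|m ih]; first by rewrite addn0 !subrr nrm0 mul0r.
  have := nrmD (Y (n + m.+1)%N x - Y (n + m)%N x) (Y (n + m)%N x - Y n x).
  by rewrite addrA subrK addnS => h; have := dY (n + m)%N x; lra.
have ylim : forall e : R, 0 < e -> exists N, forall n, y (N + n)%N - y N <= e.
  move=> e e0; pose D := range y.
  have hD : has_sup D.
    split; first by exists (y 0), 0.
    by exists 1 => _ [n _ <-]; have /andP[] := y01 n.
  have [_ [N _ <-] hN] := sup_adherent e0 hD.
  exists N => n; have : y (N + n)%N <= sup D.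
    by apply: ub_le_sup; [exact: hD.2|exists (N + n)%N].
  lra.
have [L bL YL] : exists2 L, bounded_op L & oplim Y L.
  apply: oplim_exists => [n|e e0]; first exact: (saY n).1.
  have [N hN] := ylim _ (divr_gt0 e0 (ltr0n _ 2)).
  exists N => m n /subnKC <- /subnKC <- x.
  have := nrmB (Y (N + (m - N))%N x - Y N x) (Y (N + (n - N))%N x - Y N x).
  rewrite opprB addrA subrK => h; have := nrm_ge0 x.
  have := dYm (m - N)%N N x; have := dYm (n - N)%N N x.
  by have := hN (m - N)%N; have := hN (n - N)%N => *; nra.
have sL := oplim_sa bL YL saY.
have nL x : nrm (L x) <= nrm x.
  rewrite -[L x]subr0; apply: nlim_const_le (oplim_nlim YL x) _; exists 0 => n _.
  rewrite subr0; apply: le_trans (Yn n x) _.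
  by have /andP[_ h] := y01 n; have := nrm_ge0 x; nra.
have Leq x : L x = (2^-1)%:C *: (B x + L (L x)).
  apply: (@nlim_unique _ _ (fun n => Y n.+1 x)).
    by move=> e e0; have [N hN] := oplim_nlim YL x e0; exists N => n Nn; apply/hN/leqW.
  apply: (@nlim_bop _ _ _ (fun n => B x + Y n (Y n x)) _ (bounded_op_scale H (2^-1)%:C)).
  apply: nlimD; first by move=> e e0; exists 0 => n _; rewrite subrr nrm0 ltW.
  move=> e e0; have e20 : 0 < e / 2 by rewrite divr_gt0.
  have [N hN] := oplim_nlim YL x e20; have [M hM] := oplim_nlim YL (L x) e20.
  exists (maxn N M) => n; rewrite geq_max => /andP[/hN h1 /hM h2].
  have := nrmD (Y n (Y n x - L x)) (Y n (L x) - L (L x)).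
  rewrite (bopB (saY n).1) addrA subrK -(bopB (saY n).1) => h3.
  have := Yn n (Y n x - L x); have /andP[_ h] := y01 n; have := nrm_ge0 (Y n x - L x) => *; nra.
exists (id \- L); split.
- by apply: saB => //; exact: sa_id.
- move=> x /=; rewrite ipBl -nrm2 subr_ge0; apply: le_trans (ip_le_nrm _ _) _.
  by rewrite expr2; apply: ler_wpM2r => //; exact: nrm_ge0.
- move=> x /=; rewrite (bopB bL); have := congr1 (fun u => (2 : R)%:C *: u) (Leq x).
  rewrite scalerA -rmorphM mulfV ?pnatr_eq0// scale1r => h.
  have -> : B x = (2 : R)%:C *: L x - L (L x) by rewrite h addrK.
  have -> : (2 : R)%:C *: L x = L x + L x.
    by rewrite (_ : (2 : R)%:C = 1 + 1) ?scalerDl ?scale1r// -rmorphD.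
  by rewrite !opprB opprD -addrA; congr (_ + _); rewrite addrCA.
- move=> Z bZ ZB x /=; rewrite (bopB bZ); congr (_ - _).
  apply: (oplim_comm bZ YL) => n {x}; elim: n => [|n ih] x; first by rewrite /= bop0.
  by rewrite !YS (bopZ bZ) (bopD bZ) ZB !ih.
Qed.

Lemma positive_sqrt A : positive_op A ->
  exists S, [/\ positive_op S, S \o S = A
    & forall Z, bounded_op Z -> opcomm Z A -> opcomm Z S].
Proof.
move=> pA; have sA := positive_sa pA; have [k k0 hk] := bop_bound sA.1.
(* 1 - A / k is a contraction: |x - A x / k|^2 <= |x|^2 - <A x, x> / k by [positive_norm2]. *)
have sB : sa (id \- (fun x => (k^-1)%:C *: A x)).
  by apply: saB; [exact: sa_id|exact: saZ].
have [x|S [sS pS SS cS]] := sqrt_contraction sB.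
  have := positive_norm2 pA k0 hk x => h.
  apply: ler_nrm2; first exact: nrm_ge0.
  rewrite /= -nrm2 nrm2B ipZr nrmZ ger0_norm ?invr_ge0 ?(ltW k0)// exprMn (ipC x).
  have -> : k^-1 ^+ 2 * nrm (A x) ^+ 2 = k^-1 * (k^-1 * nrm (A x) ^+ 2) by rewrite expr2 mulrA.
  have h2 : k^-1 * nrm (A x) ^+ 2 <= ip (A x) x by rewrite mulrC ler_pdivrMr// mulrC.
  have k1 : 0 <= k^-1 by rewrite invr_ge0 ltW.
  have := ler_wpM2l k1 h2; have := mulr_ge0 k1 (positive_ip x pA).
  move=> *; lra.
exists (fun x => (Num.sqrt k)%:C *: S x); split.
- apply/positive_opP; split; first exact: saZ.
  by move=> x; rewrite ipZl mulr_ge0 ?sqrtr_ge0.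
- apply/funext => x /=; rewrite (bopZ sS.1) scalerA -rmorphM -expr2 sqr_sqrtr ?(ltW k0)//.
  by rewrite SS /= opprB addrC subrK scalerA -rmorphM mulfV ?gt_eqF// scale1r.
- move=> Z bZ ZA x; rewrite (bopZ bZ) cS// => u /=.
  by rewrite (bopB bZ) (bopZ bZ) ZA.
Qed.

Lemma positive_ip_eq0 A x : positive_op A -> ip (A x) x = 0 -> A x = 0.
Proof.
move=> pA h; have [k k0 hk] := bop_bound (positive_sa pA).1.
have := positive_norm2 pA k0 hk x; rewrite h mulr0 => h2.
by apply: nrm_eq0; apply/eqP; rewrite -sqrf_eq0 eq_le h2 sqr_ge0.
Qed.

(** Any root commutes with its square, hence with the root Q built by [positive_sqrt]; so both roots
    may be compared with Q. For commuting roots, y = S1 x - S2 x satisfies (S1 + S2) y = 0;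
    positivity gives S1 y = S2 y = 0, and then <y, y> = <x, S1 y - S2 y> = 0. *)
Lemma positive_sqrt_unique S S' : positive_op S -> positive_op S' ->
  S \o S = S' \o S' -> S = S'.
Proof.
suff main S1 S2 : positive_op S1 -> positive_op S2 -> S1 \o S1 = S2 \o S2 ->
    opcomm S2 S1 -> S1 = S2.
  move=> pS pS' SS; have pA : positive_op (S \o S).
    apply/positive_opP; have sS := positive_sa pS; split; first by apply: sa_comp.
    by move=> x; rewrite /= sS.2 ip_ge0.
  have [Q [pQ QQ cQ]] := positive_sqrt pA.
  rewrite -(main Q S)//; last by apply: cQ => //; exact: (positive_sa pS).1.
  rewrite -[RHS](main Q S')//; first by rewrite QQ.
  apply: cQ => [|x]; first exact: (positive_sa pS').1.
  by rewrite SS.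
move=> p1 p2 SS c12; have [s1 s2] := (positive_sa p1, positive_sa p2).
apply/funext => x; apply/eqP; rewrite -subr_eq0; apply/eqP.
pose y := S1 x - S2 x.
have sum0 : S1 y + S2 y = 0.
  rewrite (bopB s1.1) (bopB s2.1) (c12 x).
  have /(congr1 (fun f => f x))/= -> := SS.
  by rewrite addrA subrK subrr.
have h : ip (S1 y) y + ip (S2 y) y = 0 by rewrite -ipDl sum0 ip0l.
have h1 := positive_ip y p1; have h2 := positive_ip y p2.
have y1 : S1 y = 0 by apply: positive_ip_eq0 => //; lra.
have y2 : S2 y = 0 by apply: positive_ip_eq0 => //; lra.
by apply: ip_eq0; rewrite -/y {1}/y ipBl s1.2 s2.2 y1 y2 !ip0r subrr.
Qed.

Lemma op_sqrt_eq A S : positive_op S -> S \o S = A -> op_sqrt A = S.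
Proof.
move=> pS SS; have [p q] : [set S | positive_op S /\ S \o S = A] (op_sqrt A).
  by apply: getPex; exists S.
by apply: positive_sqrt_unique => //; rewrite q.
Qed.

Lemma op_sqrtP A : positive_op A -> [/\ positive_op (op_sqrt A), op_sqrt A \o op_sqrt A = A
    & forall Z, bounded_op Z -> opcomm Z A -> opcomm Z (op_sqrt A)].
Proof. by move=> /positive_sqrt[S [pS SS cS]]; rewrite (op_sqrt_eq pS SS). Qed.

End SelfAdjoint.

(** * The spectral theorem *)

Section Resolutions.
Context (R : realType) (H : hilbertType R).
Implicit Types (A B C S T Z : H -> H) (x y z : H) (E : R -> H -> H).

Definition resolution (I : finType) (P : I -> H -> H) :=
  [/\ forall i, sa (P i), forall i x, P i (P i x) = P i x,
      forall i j x, i != j -> P i (P j x) = 0 & forall x, \sum_i P i x = x].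

Lemma resolution_norm (I : finType) (P : I -> H -> H) x :
  resolution P -> nrm x ^+ 2 = \sum_i nrm (P i x) ^+ 2.
Proof.
move=> [sP PP Pij P1]; rewrite nrm2 -[in X in ip X _](P1 x) ip_suml.
by apply: eq_bigr => i _; rewrite -{1}PP (sP i).2 nrm2.
Qed.

(** Pythagoras twice: Z preserves the orthogonal blocks of x, so the bounds on blocks do not
    accumulate with their number. *)
Lemma resolution_bound (I : finType) (P : I -> H -> H) Z (e : R) :
  resolution P -> (forall i, opcomm Z (P i)) -> 0 <= e ->
  (forall i x, nrm (Z (P i x)) <= e * nrm (P i x)) -> forall x, nrm (Z x) <= e * nrm x.
Proof.
move=> hP ZP e0 h x; apply: ler_nrm2; first by rewrite mulr_ge0 ?nrm_ge0.
rewrite -nrm2 (resolution_norm _ hP) exprMn (resolution_norm x hP) mulr_sumr.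
apply: ler_sum => i _; rewrite -exprMn -ZP.
by rewrite ler_pXn2r// nnegrE ?mulr_ge0 ?nrm_ge0.
Qed.

Definition combination (I : finType) (P : I -> H -> H) (c : I -> R) x : H :=
  \sum_i (c i)%:C *: P i x.

Lemma combination_res (I : finType) (P : I -> H -> H) (c : I -> R) i x :
  resolution P -> combination P c (P i x) = (c i)%:C *: P i x.
Proof.
move=> [sP PP Pij P1]; rewrite /combination (bigD1 i)//= PP big1 ?addr0// => j ji.
by rewrite Pij// scaler0.
Qed.

Lemma combination_res_comm (I : finType) (P : I -> H -> H) (c : I -> R) i :
  resolution P -> opcomm (combination P c) (P i).
Proof.
move=> hP x; rewrite combination_res//; case: hP => [sP PP Pij P1].
rewrite (bop_sum (sP i).1) (bigD1 i)//= (bopZ (sP i).1) PP big1 ?addr0// => j ji.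
by rewrite (bopZ (sP i).1) Pij 1?eq_sym// scaler0.
Qed.

Lemma combination_approx (I : finType) (P : I -> H -> H) (c : I -> R) Y (e : R) :
  resolution P -> bounded_op Y -> (forall i, opcomm Y (P i)) -> 0 <= e ->
  (forall i x, P i x = x -> nrm (Y x - (c i)%:C *: x) <= e * nrm x) ->
  forall x, nrm (combination P c x - Y x) <= e * nrm x.
Proof.
move=> hP bY YP e0 h; apply: (resolution_bound (Z := combination P c \- Y) hP) => //.
  move=> i x /=; rewrite (combination_res_comm c i hP) YP.
  by case: hP => sP _ _ _; rewrite (bopB (sP i).1).
move=> i x /=; rewrite combination_res// nrmC; apply: h.
by case: hP.
Qed.

Lemma resolution_prod (I J : finType) (P : I -> H -> H) (Q : J -> H -> H) :
  resolution P -> resolution Q -> (forall i j, opcomm (P i) (Q j)) ->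
  resolution (fun k : I * J => P k.1 \o Q k.2).
Proof.
move=> [sP PP Pij P1] [sQ QQ Qij Q1] PQ; split.
- by move=> [i j]; apply: sa_comp.
- by move=> [i j] x /=; rewrite -PQ PP QQ.
- move=> [i j] [i' j'] x /=; rewrite xpair_eqE negb_and => /orP[h|h].
    by rewrite -PQ Pij// (bop0 (sQ _).1).
  by rewrite -PQ [in X in P i (P i' X)]Qij// !(bop0 (sP _).1).
- move=> x; rewrite -[RHS]P1 -(pair_bigA _ (fun i j => P i (Q j x)))/=.
  by apply: eq_bigr => i _; rewrite -(bop_sum (sP i).1) Q1.
Qed.

Definition projection_family E := (forall s, orthogonal_projection (E s)) /\
  forall s t, s <= t -> forall x, E s (E t x) = E s x.

Lemma orthogonal_projectionP A : orthogonal_projection A <->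
  sa A /\ forall x, A (A x) = A x.
Proof.
split=> [[bA AA aA]|[sA AA]].
  by split=> [|x]; [split=> //; exact/is_adjoint_ip|rewrite -[in RHS]AA].
by split; [exact: sA.1|exact/funext|exact: sa_adjoint].
Qed.

Lemma projection_familyr E s t x : projection_family E -> s <= t -> E t (E s x) = E s x.
Proof.
move=> [pE mE] st.
have [/orthogonal_projectionP[ss _] /orthogonal_projectionP[tt _]] := (pE s, pE t).
by apply: ip_ext => z; rewrite -tt.2 -!ss.2 mE.
Qed.

Lemma projection_norm A x : orthogonal_projection A -> nrm (A x) <= nrm x.
Proof.
move=> /orthogonal_projectionP[sA AA].
have [/nrm_le0->|h] := leP (nrm (A x)) 0; first by rewrite nrm0 nrm_ge0.
rewrite -(ler_pM2l h) -expr2 nrm2 sA.2 AA mulrC; rewrite ipC mulrC; exact: ip_le_nrm.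
Qed.

Section Partition.
Variables (E : R -> H -> H) (a b : R) (s : seq R) (t : nat -> R).
Hypotheses (hE : projection_family E) (cE : carried E a b) (hs : tagged_partition a b s t).

Let p i := nth b (a :: s) i.

Lemma partition_le i j : (i <= j)%N -> (j <= size s)%N -> p i <= p j.
Proof.
move=> ij js; have [[ps _] _] := hs.
have sorted_s : sorted <=%O (a :: s) by apply: sub_path ps => u v /ltW.
apply: (sorted_leq_nth le_trans le_refl b sorted_s) => //.
by rewrite inE/= ltnS (leq_trans ij).
Qed.

Lemma partition_last : p (size s) = b.
Proof. by have [[_ /eqP]] := hs; rewrite /p (last_nth b). Qed.

Lemma partition_tag i : (i < size s)%N -> a <= t i <= b.
Proof.
move=> si; have [_ /(_ i si)/andP[h1 h2]] := hs; apply/andP; split.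
  by apply: le_trans h1; apply: (@partition_le 0%N) => //; exact: ltnW.
by apply: le_trans h2 _; rewrite -[leRHS]partition_last; exact: partition_le.
Qed.

Lemma increment_fixed i x : (i < size s)%N -> increment E a b s i x = x ->
  E (p i) x = 0 /\ E (p i.+1) x = x.
Proof.
move=> si h; have [pE mE] := hE.
have [sa1 E1] := (orthogonal_projectionP _).1 (pE (p i)).
have [sa2 E2] := (orthogonal_projectionP _).1 (pE (p i.+1)).
have le := partition_le (leqnSn i) si.
split; rewrite -[in LHS]h /increment /= -/(p i.+1) -/(p i).
  by rewrite (bopB sa1.1) mE// E1 subrr.
by rewrite (bopB sa2.1) E2 (projection_familyr _ hE le).
Qed.

Lemma increment_resolution :
  resolution (fun i : 'I_(size s) => increment E a b s i).
Proof.
have [pE mE] := hE; have spE u := ((orthogonal_projectionP _).1 (pE u)).1.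
have PP i j x : (i <= size s)%N -> (j <= size s)%N ->
    E (p i) (E (p j) x) = E (p (minn i j)) x.
  move=> si sj; case: (leqP i j) => [ij|/ltnW ji].
    by rewrite mE//; exact: partition_le.
  by rewrite projection_familyr//; exact: partition_le.
have mul (i j : 'I_(size s)) x : increment E a b s i (increment E a b s j x) =
    E (p (minn i.+1 j.+1)) x - E (p (minn i.+1 j)) x
    - (E (p (minn i j.+1)) x - E (p (minn i j)) x).
  have incE k y : increment E a b s k y = E (p k.+1) y - E (p k) y by [].
  rewrite !incE; have [h1 h2] := (ltn_ord i, ltn_ord j).
  by rewrite !(bopB (spE _).1) !PP ?(ltnW h1) ?(ltnW h2)//.
split.
- by move=> i; apply: saB.
- move=> i x; rewrite mul !minnn (minn_idPr (leqnSn i)) (minn_idPl (leqnSn i)).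
  by rewrite subrr subr0.
- move=> i j x ij; rewrite mul.
  have [lij|lji|/val_inj eij] := ltngtP i j; last by rewrite eij eqxx in ij.
    have h := ltnW lij; rewrite (minn_idPl (h : (i.+1 <= j.+1)%N)) (minn_idPl lij).
    by rewrite (minn_idPl (leqW h)) !subrr.
  have h := ltnW lji; rewrite (minn_idPr (h : (j.+1 <= i.+1)%N)) (minn_idPr lji).
  by rewrite (minn_idPr (leqW h)) subrr.
- move=> x; rewrite -(big_mkord xpredT (fun i => increment E a b s i x)).
  rewrite (telescope_sumr (fun i => E (p i) x))// partition_last.
  by case: cE => -> ->; rewrite subr0.
Qed.

Lemma increment_comm Z i : bounded_op Z -> (forall u, opcomm Z (E u)) ->
  opcomm Z (increment E a b s i).
Proof. by move=> bZ ZE x; rewrite /increment /= (bopB bZ) !ZE. Qed.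

End Partition.

(** If b < a, then 1 = E_b = E_b E_a = 0. The zero space is thus the one case where a carrying
    interval admits no partition, and it has to be treated apart below. *)
Lemma carried_le E a b : projection_family E -> carried E a b -> a <= b \/ forall x, x = 0.
Proof.
move=> hE [Ea Eb]; case: (leP a b) => [|/ltW ba]; [by left|right=> x].
by have := hE.2 b a ba x; rewrite Ea Eb.
Qed.

Lemma fine_partition a b (d : R) : a <= b -> 0 < d ->
  exists s t, tagged_partition a b s t /\ mesh_lt a b s d.
Proof.
move=> ab d0.
suff [s [ps ms]] : exists s, itv_partition a b s /\ mesh_lt a b s d.
  exists s, (fun i => nth b (a :: s) i); split=> //; split=> // i si; rewrite lexx andTb.
  have sorted_s : sorted <=%O (a :: s) by case: ps => + _; apply: sub_path => u v /ltW.
  by apply: (sorted_leq_nth le_trans le_refl b sorted_s) => //; rewrite inE/= ltnS// ltnW.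
have [n hn] : exists n : nat, b - a < n%:R * (d / 2).
  exists (Num.bound ((b - a) / (d / 2))); rewrite -ltr_pdivrMr; last lra.
  by apply: archi_boundP; rewrite divr_ge0//; lra.
elim: n a ab hn => [|n ih] a ab hn; first by lra.
have [->|ab'] := eqVneq a b; first by exists [::]; split=> //; split=> //=.
have {}ab : a < b by rewrite lt_neqAle ab'.
have [bd|bd] := ltP (b - a) d.
  exists [:: b]; split; first by split=> //=; rewrite ab.
  by move=> [|i]//= _.
have [||s [[ps ls] ms]] := ih (a + d / 2); first by lra.
  by move: hn; rewrite -natr1 mulrDl mul1r; lra.
exists (a + d / 2 :: s); split.
  by split=> //=; rewrite ps andbT; lra.
by move=> [_|i]/=; [lra|exact: ms].
Qed.

End Resolutions.

(** * Construction of the spectral family of a self-adjoint operator *)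

Section SpectralTheorem.
Context (R : realType) (H : hilbertType R).
Implicit Types (A B C S T Z : H -> H) (x y z : H) (E : R -> H -> H).

(** Uniqueness of the orthogonal decomposition ([uniq]) gives linearity and commutation alike. A
    self-adjoint Z commuting with G leaves both the kernel of G and its orthogonal complement
    invariant. *)
Lemma kernel_projection (G : H -> H) : sa G -> exists E : H -> H, [/\ orthogonal_projection E,
  forall x, E x = x <-> G x = 0,
  forall x, E x = 0 <-> forall w, G w = 0 -> ip x w = 0
  & forall Z, sa Z -> opcomm Z G -> opcomm Z E].
Proof.
move=> [bG hG].
have ex x : exists v, G v = 0 /\ forall w, G w = 0 -> ip (x - v) w = 0.
  have [] := @projection_theorem _ _ [set v | G v = 0] _ _ _ _ x.
  - exact: bop0.
  - by move=> u v /= hu hv; rewrite bopD// hu hv addr0.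
  - by move=> r u /= hu; rewrite bopZ// hu scaler0.
  - move=> u l hu ul /=; apply: nlim_unique (nlim_bop bG ul) _.
    by move=> e e0; exists 0 => n _; rewrite /= hu subrr nrm0 ltW.
  - by move=> v hv orth; exists v.
have [E hE] := choice ex.
have uniq x v : G v = 0 -> (forall w, G w = 0 -> ip (x - v) w = 0) -> E x = v.
  move=> Gv xv; apply/eqP; rewrite -subr_eq0; apply/eqP/ip_eq0.
  have Gd : G (E x - v) = 0 by rewrite bopB// (hE x).1 Gv subrr.
  have h1 := xv _ Gd; have h2 := (hE x).2 _ Gd; rewrite ipBl in h1; rewrite ipBl in h2.
  by rewrite ipBl; lra.
have lE : linear E.
  move=> c x y; apply: uniq; first by rewrite bopD// bopZ// (hE x).1 (hE y).1 scaler0 addr0.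
  move=> w Gw; rewrite opprD addrACA -scalerBr ipDl ipZcl (hE y).2// addr0.
  by apply: (hE x).2; rewrite bopZ// Gw scaler0.
have pyth x : nrm (E x) <= nrm x.
  have h : ip x (E x) = nrm (E x) ^+ 2.
    by apply/eqP; rewrite nrm2 -subr_eq0 -ipBl (hE x).2 ?(hE x).1.
  have [/nrm_le0->|n0] := leP (nrm (E x)) 0; first by rewrite nrm0 nrm_ge0.
  by rewrite -(ler_pM2r n0) -expr2 -h ip_le_nrm.
have bE : bounded_op E.
  by apply/bounded_opP; split=> //; exists 1 => // x; rewrite mul1r.
have fixE x : E x = x <-> G x = 0.
  split=> [<-|Gx]; first exact: (hE x).1.
  by apply: uniq => // w _; rewrite subrr ip0l.
have sE : sa E.
  split=> // x y; have h u v : ip (E u) v = ip (E u) (E v).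
    by apply/eqP; rewrite -subr_eq0 -ipBr ipC (hE v).2 ?(hE u).1.
  by rewrite h ipC -h ipC.
have kerE x : E x = 0 <-> forall w, G w = 0 -> ip x w = 0.
  split=> [Ex w Gw|h]; first by rewrite -[x]subr0 -Ex; exact: (hE x).2.
  by apply: uniq => [|w Gw]; [exact: bop0|rewrite subr0 h].
exists E; split=> //.
  by apply/orthogonal_projectionP; split=> // x; apply/fixE; exact: (hE x).1.
move=> Z [bZ hZ] ZG x; apply/esym/uniq; first by rewrite -ZG (hE x).1 bop0.
by move=> w Gw; rewrite -bopB// hZ; apply: (hE x).2; rewrite -ZG Gw bop0.
Qed.

(** A description of the spectral family by quadratic forms, free of integrals and limits. The last
    clause makes the form of A - s strictly positive off 0 on the kernel of [E s]: eigenvectors for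
    s belong to the range of [E s], which is the source of right continuity. *)
Definition spectral_resolution A E := [/\ forall s, orthogonal_projection (E s),
  forall s Z, sa Z -> opcomm Z A -> opcomm Z (E s),
  forall s x, E s x = x -> ip (A x) x <= s * ip x x
  & forall s x, E s x = 0 -> s * ip x x <= ip (A x) x /\
      (ip (A x) x = s * ip x x -> x = 0)].

(* [E s] projects onto the kernel of [|A - s| + (A - s)], that is of twice the
   positive part of [A - s]: there [A - s] is [- |A - s|], and on the orthogonal
   complement it is [|A - s|]. *)
Lemma spectral_resolution_exists A : sa A -> exists E, spectral_resolution A E.
Proof.
move=> sA; have bA := sA.1.
suff ex (s : R) : exists P, [/\ orthogonal_projection P,
  forall Z, sa Z -> opcomm Z A -> opcomm Z P,
  forall x, P x = x -> ip (A x) x <= s * ip x x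
  & forall x, P x = 0 -> s * ip x x <= ip (A x) x /\
      (ip (A x) x = s * ip x x -> x = 0)].
  by have [E hE] := choice ex; exists E; split=> s; have [] := hE s.
pose D : H -> H := A \- (fun x => s%:C *: x).
have sD : sa D by apply: saB => //; exact: sa_scalar.
have pD2 : positive_op (D \o D).
  apply/positive_opP; split; first exact: sa_comp.
  by move=> x; rewrite /= sD.2 ip_ge0.
have [S [pS SS cS]] := positive_sqrt pD2; have sS := positive_sa pS.
have SSx x : S (S x) = D (D x) by have /(congr1 (fun f => f x)) := SS.
have cZD Z : bounded_op Z -> opcomm Z A -> opcomm Z D.
  by move=> bZ ZA x; rewrite /D /= (bopB bZ) (bopZ bZ) ZA.
have DS : opcomm D S by apply: cS => //; exact: sD.1.
have ipD x : ip (D x) x = ip (A x) x - s * ip x x by rewrite /D /= ipBl ipZl.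
have [P [pP fixP kerP cP]] := kernel_projection (saD sS sD).
exists P; split=> //.
- move=> Z sZ ZA; apply: cP => // x /=; rewrite (bopD sZ.1).
  rewrite (cZD _ sZ.1 ZA) cS//; first exact: sZ.1.
  by move=> u /=; rewrite !(cZD _ sZ.1 ZA).
- move=> x /fixP /= /eqP; rewrite addrC addr_eq0 => /eqP Dx.
  by rewrite -subr_le0 -ipD Dx ipNl oppr_le0; exact: positive_ip.
- move=> x /kerP kx; have Dx : D x = S x.
    apply/eqP; rewrite eq_sym -subr_eq0; apply/eqP/ip_eq0.
    move: {2}(S x - D x) => u.
    rewrite [X in ip X _](_ : _ = (S \- D) x)// (saB sS sD).2; apply: kx.
    by rewrite /= (bopB sS.1) (bopB sD.1) SSx DS addrA subrK subrr.
  split; first by rewrite -subr_ge0 -ipD Dx; exact: positive_ip.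
  move=> /eqP; rewrite -subr_eq0 -ipD Dx => /eqP /(positive_ip_eq0 pS) Sx.
  by apply: ip_eq0; apply: kx; rewrite /= Dx Sx addr0.
Qed.

Section SpectralResolution.
Variables (A : H -> H) (E : R -> H -> H).
Hypotheses (sA : sa A) (hE : spectral_resolution A E).

Let pE s : orthogonal_projection (E s). Proof. by case: hE. Qed.
Let sE s : sa (E s). Proof. by have /orthogonal_projectionP[] := pE s. Qed.
Let EE s x : E s (E s x) = E s x.
Proof. by have /orthogonal_projectionP[] := pE s. Qed.

Lemma spectral_comm s : opcomm A (E s).
Proof. by case: hE => _ + _ _; apply. Qed.

Lemma spectral_comm2 s t : opcomm (E t) (E s).
Proof.
case: hE => _ + _ _; apply=> // x; exact/esym/spectral_comm.
Qed.

Lemma spectral_disjoint s t x : s < t -> E s x = x -> E t x = 0 -> x = 0.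
Proof.
move=> st Es Et; case: hE => _ _ /(_ _ _ Es) h1 /(_ _ _ Et) [h2 _].
have [//|x0] := eqVneq x 0; have : 0 < ip x x.
  by rewrite lt_neqAle ip_ge0 andbT eq_sym; apply: contra_neq x0 => /ip_eq0.
by move=> ?; exfalso; nra.
Qed.

(** The vector E_s x - E_t E_s x is fixed by E_s and killed by E_t, so its form would be both at
    most s and at least t. *)
Lemma spectral_projection_family : projection_family E.
Proof.
split=> // s t; rewrite le_eqVlt => /orP[/eqP<-//|st] x.
suff h : E t (E s x) = E s x by rewrite -[RHS]h spectral_comm2.
apply/eqP; rewrite eq_sym -subr_eq0; apply/eqP; apply: (spectral_disjoint st).
  by rewrite (bopB (sE _).1) (spectral_comm2 t s) EE.
by rewrite (bopB (sE _).1) EE subrr.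
Qed.

(** This supplies all approximate eigenvectors. The compression of A - c to the range of E_t - E_s
    has its form between s - c and t - c, and [sa_norm] turns this into a norm bound. *)
Lemma spectral_local s t c x : s <= c <= t -> E s x = 0 -> E t x = x ->
  nrm (A x - c%:C *: x) <= (t - s) * nrm x.
Proof.
move=> /andP[sc ct] Es Et; have st := le_trans sc ct.
have mE := spectral_projection_family.
pose P : H -> H := E t \- E s; pose C : H -> H := A \- (fun x => c%:C *: x).
have sP : sa P by exact: saB.
have sC : sa C by apply: saB => //; exact: sa_scalar.
have CE r u : C (E r u) = E r (C u).
  by rewrite /C /= (bopB (sE r).1) (bopZ (sE r).1) spectral_comm.
have CP : opcomm C P by move=> u; rewrite {1}/P /= (bopB sC.1) !CE.
have Px : P x = x by rewrite /P /= Es Et subr0.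
have -> : A x - c%:C *: x = (C \o P) x by rewrite /= Px.
apply: sa_norm; [exact: sa_comp|by rewrite subr_ge0|move=> u].
have PP v : P (P v) = P v.
  rewrite /P /= !(bopB (sE _).1) !EE (mE.2 _ _ st) (projection_familyr _ mE st).
  by rewrite subrr subr0.
have -> : ip ((C \o P) u) u = ip (C (P u)) (P u) by rewrite /= -PP CP sP.2 -CP PP.
have [h1 h2] : E s (P u) = 0 /\ E t (P u) = P u.
  rewrite /P /= !(bopB (sE _).1) !EE (mE.2 _ _ st) (projection_familyr _ mE st).
  by rewrite subrr.
case: hE => _ _ /(_ _ _ h2) k1 /(_ _ _ h1)[k2 _].
rewrite /C /= ipBl ipZl.
have nP : ip (P u) (P u) <= nrm u ^+ 2.
  rewrite -nrm2 ler_pXn2r// ?nnegrE ?nrm_ge0//.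
  by apply: projection_norm; apply/orthogonal_projectionP; split.
have n0 := ip_ge0 (P u).
by rewrite ler_norml; apply/andP; split; nra.
Qed.

(* If E_s y = 0, then y is a limit of vectors (A - s) u with E_s u = 0, on which
   E_t is of size O(t - s). *)
Lemma spectral_right_continuous s x (e : R) : 0 < e ->
  exists2 d : R, 0 < d & forall t, s < t -> t < s + d -> nrm (E t x - E s x) <= e.
Proof.
move=> e0; pose y := x - E s x.
have Ey : E s y = 0 by rewrite (bopB (sE _).1) EE subrr.
pose D : H -> H := A \- (fun x => s%:C *: x).
have sD : sa D by apply: saB => //; exact: sa_scalar.
have DE t : opcomm D (E t).
  by move=> u; rewrite /D /= (bopB (sE _).1) (bopZ (sE _).1) spectral_comm.
pose V : set H := [set l | forall e : R, 0 < e -> exists2 u, E s u = 0 & nrm (D u - l) <= e].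
have [] := @projection_theorem _ _ V _ _ _ _ y.
- move=> e' e'0; exists 0; first exact: (bop0 (sE _).1).
  by rewrite (bop0 sD.1) subrr nrm0 ltW.
- move=> l l' hl hl' e' e'0; have e'2 : 0 < e' / 2 by rewrite divr_gt0.
  have [u Eu hu] := hl _ e'2; have [v Ev hv] := hl' _ e'2.
  exists (u + v); first by rewrite (bopD (sE _).1) Eu Ev addr0.
  rewrite (bopD sD.1) opprD addrACA; apply: le_trans (nrmD _ _) _; lra.
- move=> r l hl e' e'0; have r0 : 0 < `|r| + 1 by rewrite ltr_wpDl.
  have [u Eu hu] := hl _ (divr_gt0 e'0 r0).
  exists (r%:C *: u); first by rewrite (bopZ (sE _).1) Eu scaler0.
  rewrite (bopZ sD.1) -scalerBr nrmZ; apply: le_trans (ler_wpM2l _ hu) _ => //.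
  by rewrite mulrCA ger_pMr// ler_pdivrMr// mul1r lerDl.
- move=> u l hu ul e' e'0; have e'2 : 0 < e' / 2 by rewrite divr_gt0.
  have [N hN] := ul _ e'2; have [w Ew hw] := hu N _ e'2.
  exists w => //; have := nrmD (D w - u N) (u N - l); rewrite addrA subrK.
  have := hN N (leqnn _) => h1 h2; lra.
move=> v Vv orth.
have Ev : E s v = 0.
  apply/nrm_le0/ler_addgt0Pr => e' e'0; have [u Eu hu] := Vv _ e'0.
  rewrite add0r -nrmN -[- _]add0r -(bop0 sD.1) -Eu (DE s) -(bopB (sE s).1).
  exact: le_trans (projection_norm _ (pE s)) hu.
(* y - v is orthogonal to (A - s) (y - v), so the form of A - s vanishes there; the strictness
   clause of [spectral_resolution] then gives y - v = 0. *)
have yv : y = v.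
  apply/eqP; rewrite -subr_eq0; apply/eqP.
  have Eyv : E s (y - v) = 0 by rewrite (bopB (sE _).1) Ey Ev subrr.
  have VD : V (D (y - v)).
    by move=> e' e'0; exists (y - v); rewrite // subrr nrm0 ltW.
  case: hE => _ _ _ /(_ _ _ Eyv)[_]; apply.
  have := orth _ VD; rewrite ipC /D /= [X in X = 0 -> _]ipBl [X in _ - X]ipZl => /eqP.
  by rewrite subr_eq0 => /eqP.
have e2 : 0 < e / 2 by rewrite divr_gt0.
have [u Eu hu] := Vv _ e2.
have u1 : 0 < nrm u + 1 by rewrite ltr_wpDl ?nrm_ge0.
exists (e / 2 / (nrm u + 1)) => [|t st ts]; first by rewrite divr_gt0.
have mE := spectral_projection_family.
have -> : E t x - E s x = E t y.
  by rewrite (bopB (sE _).1) (projection_familyr _ mE (ltW st)).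
have h1 : nrm (E t (D u)) <= (t - s) * nrm u.
  rewrite -DE; apply: (@le_trans _ _ ((t - s) * nrm (E t u))).
    apply: spectral_local; rewrite ?lexx ?ltW//.
    by rewrite spectral_comm2 Eu (bop0 (sE _).1).
  by apply: ler_wpM2l; [rewrite subr_ge0 ltW|exact: projection_norm].
have h2 : nrm (E t (D u - y)) <= e / 2.
  by apply: le_trans (projection_norm _ (pE t)) _; rewrite yv.
rewrite -[y](subKr (D u)) (bopB (sE t).1); apply: le_trans (nrmB _ _) _.
have : (t - s) * (nrm u + 1) <= e / 2.
  by rewrite -ler_pdivlMr//; lra.
by have := nrm_ge0 u => *; nra.
Qed.

Lemma spectral_eq0 (m s : R) : (forall x, m * ip x x <= ip (A x) x) -> s < m -> E s = \0.
Proof.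
move=> hm sm; apply/funext => x /=; case: hE => _ _ /(_ _ _ (EE s x)) h _.
have := hm (E s x) => h2; apply: ip_eq0; apply/eqP; rewrite eq_le ip_ge0 andbT.
by have := ip_ge0 (E s x); nra.
Qed.

Lemma spectral_eq1 (M s : R) : (forall x, ip (A x) x <= M * ip x x) -> M <= s -> E s = id.
Proof.
move=> hM sM; apply/funext => x /=; apply/eqP; rewrite eq_sym -subr_eq0; apply/eqP.
have Es : E s (x - E s x) = 0 by rewrite (bopB (sE _).1) EE subrr.
case: hE => _ _ _ /(_ _ _ Es)[h1]; apply; apply/eqP; rewrite eq_le h1 andbT.
apply: le_trans (hM _) _; apply: ler_wpM2r => //; exact: ip_ge0.
Qed.

(** Strictness is asked at the left end only: E_m is nonzero when m is an eigenvalue, whereas E_M is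
    already the identity. *)
Lemma spectral_carried (m M a b : R) : (forall x, m * ip x x <= ip (A x) x) ->
  (forall x, ip (A x) x <= M * ip x x) -> a < m -> M <= b -> carried E a b.
Proof. by move=> hm hM am Mb; split; [exact: spectral_eq0 am|exact: spectral_eq1 Mb]. Qed.

(** Each block of a fine partition consists of approximate eigenvectors for its tag, so Y is close
    there to f at the tag; [combination_approx] assembles the blocks. *)
Lemma spectral_integralP a b f Y : carried E a b -> bounded_op Y ->
  (forall s, opcomm Y (E s)) ->
  (forall e : R, 0 < e -> exists2 d : R, 0 < d & forall c x, a <= c <= b ->
     nrm (A x - c%:C *: x) <= d * nrm x -> nrm (Y x - (f c)%:C *: x) <= e * nrm x) ->
  is_spectral_integral E a b f Y.
Proof.
move=> cE bY YE hY e e0; have [d d0 hd] := hY _ e0.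
exists d => // s t hs ms x; rewrite ler_nrm.
have mE := spectral_projection_family.
rewrite -[X in nrm (X - _)]/(combination
  (fun i : 'I_(size s) => increment E a b s i) (fun i => f (t i)) x).
apply: (combination_approx (increment_resolution mE cE hs) bY) => [i||i {}x Px].
- exact: increment_comm.
- exact: ltW.
have [h1 h2] := increment_fixed mE hs (ltn_ord i) Px.
apply: hd; first exact: (partition_tag hs (ltn_ord i)).
have /andP[t1 t2] := hs.2 _ (ltn_ord i).
apply: le_trans (spectral_local _ h1 h2) _; first by rewrite t1 t2.
by apply: ler_wpM2r; [exact: nrm_ge0|exact/ltW/ms].
Qed.

Lemma spectral_resolution_family : is_spectral_family A E.
Proof.
have mE := spectral_projection_family.
split=> //.
- move=> s t st; split; [exact: (sE s).1|exact: (sE t).1|].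
  apply/positive_opP; split; first exact: saB.
  move=> x; have PP : (E t \- E s) ((E t \- E s) x) = (E t \- E s) x.
    by rewrite /= !(bopB (sE _).1) !EE (mE.2 _ _ st) (projection_familyr _ mE st) subrr subr0.
  by rewrite -PP (saB (sE t) (sE s)).2 ip_ge0.
- move=> s x; apply/cvgrPdist_le => e e0.
  have [r er] : exists r, e = r%:C by apply/complex_realP; rewrite gtr0_real.
  move: e0; rewrite er ltcR => r0.
  have [d d0 hd] := spectral_right_continuous s x r0.
  near=> t; rewrite nrmE lecR nrmC; apply: hd; near: t.
    exact: nbhs_right_gt.
  by apply: nbhs_right_lt; rewrite ltrDl.
have [k k0 hk] := bop_bound sA.1.
have hM x : ip (A x) x <= k * ip x x.
  by apply: le_trans (ip_le_nrm _ _) _; rewrite -nrm2 expr2 mulrA ler_wpM2r ?nrm_ge0.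
have hm x : - k * ip x x <= ip (A x) x.
  rewrite mulNr lerNl -ipNl; apply: le_trans (ip_le_nrm _ _) _.
  by rewrite nrmN -nrm2 expr2 mulrA ler_wpM2r ?nrm_ge0.
have cE : carried E (- k - 1) k by apply: (spectral_carried hm hM); lra.
exists (- k - 1), k; split=> //; apply: spectral_integralP => //.
- exact: sA.1.
- exact: spectral_comm.
- by move=> e e0; exists e.
Unshelve. all: by end_near. Qed.

End SpectralResolution.
End SpectralTheorem.

(** * Uniqueness of the spectral family and of spectral integrals *)

Section SpectralUniqueness.
Context (R : realType) (H : hilbertType R).
Implicit Types (A B C S T Y Z : H -> H) (x y z : H) (E : R -> H -> H).

Lemma eq_op_approx Y Y' (k : R) :
  (forall (e : R) x, 0 < e -> nrm (Y x - Y' x) <= k * e * nrm x) -> Y = Y'.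
Proof.
move=> h; apply/funext => x; apply/eqP; rewrite -subr_eq0; apply/eqP/nrm_le0.
apply/ler_addgt0Pr => e e0; rewrite add0r.
have p0 : 0 < `|k| * nrm x + 1 by rewrite ltr_wpDl// mulr_ge0// nrm_ge0.
apply: le_trans (h (e / (`|k| * nrm x + 1)) x _) _; first by rewrite divr_gt0.
rewrite mulrAC mulrA ler_pdivrMr// mulrC ler_pM2l//.
apply: le_trans (ler_norm _) _; rewrite normrM (ger0_norm (nrm_ge0 _)); lra.
Qed.

Lemma spectral_integral_unique E a b f Y Y' : projection_family E -> carried E a b ->
  is_spectral_integral E a b f Y -> is_spectral_integral E a b f Y' -> Y = Y'.
Proof.
move=> mE cE hY hY'; have [ab|triv] := carried_le mE cE; last first.
  by apply/funext => x; rewrite (triv (Y x)) (triv (Y' x)).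
apply: (@eq_op_approx _ _ 2) => e x e0.
have [d d0 hd] := hY e e0; have [d' d'0 hd'] := hY' e e0.
have dd : 0 < Num.min d d' by rewrite lt_min d0.
have [s [t [ps ms]]] := fine_partition ab dd.
have ms1 : mesh_lt a b s d by move=> i /ms /lt_le_trans; apply; rewrite ge_min lexx.
have ms2 : mesh_lt a b s d' by move=> i /ms /lt_le_trans; apply; rewrite ge_min lexx orbT.
have := hd _ _ ps ms1 x; have := hd' _ _ ps ms2 x; rewrite !ler_nrm => h1 h2.
rewrite nrmC in h2; have := nrmD (Y x - \sum_(i < size s) (f (t i))%:C *: increment E a b s i x)
  (\sum_(i < size s) (f (t i))%:C *: increment E a b s i x - Y' x).
by rewrite addrA subrK => h3; lra.
Qed.

Section Family.
Variables (A : H -> H) (E : R -> H -> H).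
Hypotheses (sA : sa A) (hE : is_spectral_family A E).

(** For y in the range of E_s, the order gives <E_t y, y> >= <y, y>, hence |y - E_t y|^2 = <y, y> -
    <E_t y, y> <= 0. *)
Lemma family_projection : projection_family E.
Proof.
case: hE => pE leE _ _; split=> // s t st.
have [/orthogonal_projectionP[ss s2] /orthogonal_projectionP[tt t2]] := (pE s, pE t).
suff h x : E t (E s x) = E s x.
  by move=> x; apply: ip_ext => z; rewrite -ss.2 -tt.2 h ss.2.
have [_ _ /positive_opP[_ /(_ (E s x))]] := leE s t st.
rewrite /= s2 ipBl subr_ge0; set y := E s x => h.
have yy : ip (E t y) (E t y) = ip (E t y) y by rewrite tt.2 t2 ipC.
apply/eqP; rewrite eq_sym -subr_eq0; apply/eqP/ip_eq0/eqP.
rewrite eq_le ip_ge0 andbT !(ipBl, ipBr) yy (ipC y (E t y)); lra.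
Qed.

Let mE := family_projection.
Let spE s : sa (E s). Proof. by have /orthogonal_projectionP[] := mE.1 s. Qed.

Lemma family_approx (e : R) : 0 < e -> exists a b s t, [/\ carried E a b,
  tagged_partition a b s t, mesh_lt a b s e
  & forall x, nrm (\sum_(i < size s) (t i)%:C *: increment E a b s i x - A x) <= e * nrm x]
  \/ (forall x : H, x = 0).
Proof.
move=> e0; case: hE => _ _ _ [a [b [cE iE]]].
have [ab|triv] := carried_le mE cE; last by exists a, b, [::], (fun _ => 0); right.
have [d d0 hd] := iE e e0; have dd : 0 < Num.min d e by rewrite lt_min d0.
have [s [t [ps ms]]] := fine_partition ab dd.
exists a, b, s, t; left; split=> //.
  by move=> i /ms /lt_le_trans; apply; rewrite ge_min lexx orbT.
move=> x; rewrite -ler_nrm; apply: hd => // i /ms /lt_le_trans; apply.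
by rewrite ge_min lexx.
Qed.

Lemma family_comm s : opcomm A (E s).
Proof.
move=> x; apply: (congr1 (fun f => f x) (_ : A \o E s = E s \o A)).
apply: (@eq_op_approx _ _ 2) => e {}x e0.
have [a [b [p [t [[cE ps _ hp]|triv]]]]] := family_approx e0; last first.
  by rewrite (triv (_ - _)) (triv x) nrm0 mulr0.
have h1 := hp (E s x).
have h2 := le_trans (projection_norm _ (mE.1 s)) (hp x).
have h3 := projection_norm x (mE.1 s).
move: h1 h2; set W := \sum_(i < _) _ => h1.
have -> : E s (\sum_(i < size p) (t i)%:C *: increment E a b p i x - A x) = W - E s (A x).
  rewrite (bopB (spE s).1) (bop_sum (spE s).1); congr (_ - _); apply: eq_bigr => i _.
  rewrite (bopZ (spE s).1); congr (_ *: _); rewrite /increment /= (bopB (spE s).1).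
  have EE u v : E u (E v x) = E v (E u x).
    have [uv|/ltW vu] := leP u v; first by rewrite mE.2// (projection_familyr _ mE uv).
    by rewrite (mE.2 _ _ vu) (projection_familyr _ mE vu).
  by congr (_ - _); exact: EE.
rewrite nrmC in h1; move=> h2; have := nrmD (A (E s x) - W) (W - E s (A x)).
rewrite addrA subrK /= => h4.
have := ler_wpM2l (ltW e0) h3; lra.
Qed.

(** Taking c = 1 or c = -1 serves the upper and the lower bound at once. Only blocks where x has a
    nonzero component constrain the tags. One r pays for the mesh, the other for replacing A by a
    Riemann sum. *)
Lemma family_bound (c s r : R) x : `|c| <= 1 -> 0 < r ->
  (forall a b p t i, carried E a b -> tagged_partition a b p t -> mesh_lt a b p r ->
    (i < size p)%N -> increment E a b p i x != 0 -> c * t i <= s + r) ->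
  c * ip (A x) x <= (s + 2 * r) * ip x x.
Proof.
move=> c1 r0 h; have [a [b [p [t [[cE ps ms hp]|triv]]]]] := family_approx r0; last first.
  by rewrite (triv x) ip0r (ip0r 0) !mulr0.
have [sP PP Pij P1] := increment_resolution mE cE ps.
have hres : resolution (fun i : 'I_(size p) => increment E a b p i) by [].
have : c * ip (\sum_(i < size p) (t i)%:C *: increment E a b p i x) x <= (s + r) * ip x x.
  rewrite -[in X in _ <= X]nrm2 (resolution_norm x hres) mulr_sumr ip_suml mulr_sumr.
  apply: ler_sum => i _; rewrite ipZl -{1}PP (sP i).2 nrm2 mulrA.
  have [->|ne] := eqVneq (increment E a b p i x) 0; first by rewrite ip0l !mulr0.
  by apply: ler_wpM2r; [exact: ip_ge0|exact: (h a b p t i)].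
set W := \sum_(i < _) _ => h1.
have h2 : c * (ip (A x) x - ip W x) <= r * ip x x.
  apply: le_trans (ler_norm _) _; rewrite normrM.
  apply: (@le_trans _ _ (1 * `|ip (A x) x - ip W x|)); first exact: ler_wpM2r.
  rewrite mul1r -ipBl; apply: le_trans (norm_ip_le _ _) _.
  by rewrite -nrm2 expr2 mulrA; apply: ler_wpM2r; [exact: nrm_ge0|rewrite nrmC; exact: hp].
by lra.
Qed.

Lemma family_le s x : E s x = x -> ip (A x) x <= s * ip x x.
Proof.
move=> Ex; apply/ler_addgt0Pr => e e0.
have p0 : 0 < 2 * (ip x x + 1) by have := ip_ge0 x; lra.
have r0 := divr_gt0 e0 p0; set r := e / _ in r0.
have : 1 * ip (A x) x <= (s + 2 * r) * ip x x.
  apply: family_bound => //; first by rewrite normr1.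
  move=> a b p t i cE ps ms ip; apply: contra_neqT; rewrite mul1r -ltNge => h.
  have /andP[t1 t2] := ps.2 i ip; have := ms i ip => m1.
  have sp : s <= nth b (a :: p) i by lra.
  have sp' : s <= nth b (a :: p) i.+1 by lra.
  by rewrite /increment /= -Ex (projection_familyr _ mE sp) (projection_familyr _ mE sp') subrr.
rewrite mul1r => /le_trans; apply; rewrite mulrDl lerD2l mulrAC /r mulrA ler_pdivrMr//.
by have := ip_ge0 x; nra.
Qed.

Lemma family_ge s x : E s x = 0 -> s * ip x x <= ip (A x) x.
Proof.
move=> Ex; apply/ler_addgt0Pr => e e0.
have p0 : 0 < 2 * (ip x x + 1) by have := ip_ge0 x; lra.
have r0 := divr_gt0 e0 p0; set r := e / _ in r0.
have : -1 * ip (A x) x <= (- s + 2 * r) * ip x x.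
  apply: family_bound => //; first by rewrite normrN normr1.
  move=> a b p t i cE ps ms ip; apply: contra_neqT; rewrite mulN1r -ltNge => h.
  have /andP[t1 t2] := ps.2 i ip; have := ms i ip => m1.
  have sp : nth b (a :: p) i <= s by lra.
  have sp' : nth b (a :: p) i.+1 <= s by lra.
  have E0 u : E u 0 = 0 := bop0 (spE u).1.
  by rewrite /increment /= -(mE.2 _ _ sp) -(mE.2 _ _ sp') Ex !E0 subrr.
have : 2 * r * ip x x <= e.
  by rewrite mulrAC /r mulrA ler_pdivrMr//; have := ip_ge0 x; nra.
lra.
Qed.

End Family.

Lemma right_limit_eq E s x y :
  E u x @[u --> s^'+] --> E s x -> (forall t, s < t -> E t x = y) -> E s x = y.
Proof.
move=> hE h; apply/eqP; rewrite -subr_eq0; apply/eqP/nrm_le0/ler_addgt0Pr => e e0.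
have e0' : 0 < e%:C by rewrite ltcR.
have /cvgrPdist_le /(_ _ e0') hd := hE.
have [t []] : exists t, `|E s x - E t x| <= e%:C /\ s < t.
  apply: (@filter_ex _ (s^'+)); near=> t; split; near: t => //.
  exact: nbhs_right_gt.
by move=> + st; rewrite (h t st) nrmE lecR add0r.
Unshelve. all: by end_near. Qed.

(** For s < t the form bounds show that E_t fixes the range of E'_s and E'_t that of E_s. Letting t
    decrease to s, right continuity makes E_s and E'_s fix each other's range; as they commute, they
    are equal. *)
Lemma spectral_family_unique A E E' : sa A -> spectral_resolution A E ->
  is_spectral_family A E' -> E' = E.
Proof.
move=> sA hE hE'; apply/funext => s; apply/funext => x.
have mE := spectral_projection_family sA hE; have mE' := family_projection hE'.
have spE u : sa (E u) by have /orthogonal_projectionP[] := mE.1 u.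
have spE' u : sa (E' u) by have /orthogonal_projectionP[] := mE'.1 u.
have EE u z : E u (E u z) = E u z := mE.2 u u (lexx u) z.
have EE' u z : E' u (E' u z) = E' u z := mE'.2 u u (lexx u) z.
have cEE' u v : opcomm (E' v) (E u).
  by case: hE => _ + _ _; apply=> // z; rewrite -(family_comm hE').
have z0 (st : R * R) z : st.1 < st.2 -> ip (A z) z <= st.1 * ip z z ->
    st.2 * ip z z <= ip (A z) z -> z = 0.
  by move=> h h1 h2; apply: ip_eq0; have := ip_ge0 z; nra.
have h1 t z : s < t -> E t (E' s z) = E' s z.
  move=> st; apply/eqP; rewrite eq_sym -subr_eq0; apply/eqP.
  set w := _ - _; have w1 : E' s w = w by rewrite (bopB (spE' s).1) cEE' EE'.
  have w2 : E t w = 0 by rewrite (bopB (spE t).1) EE subrr.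
  apply: (z0 (s, t)) => //=; first exact: family_le hE' _ _ w1.
  by case: hE => _ _ _ /(_ _ _ w2)[].
have h2 t z : s < t -> E' t (E s z) = E s z.
  move=> st; apply/eqP; rewrite eq_sym -subr_eq0; apply/eqP.
  set w := _ - _; have w1 : E s w = w by rewrite (bopB (spE s).1) -cEE' EE.
  have w2 : E' t w = 0 by rewrite (bopB (spE' t).1) EE' subrr.
  apply: (z0 (s, t)) => //=; last exact: family_ge hE' _ _ w2.
  by case: hE => _ _ /(_ _ _ w1).
have [_ _ rE _] := spectral_resolution_family sA hE.
have [_ _ rE' _] := hE'.
have e1 : E s (E' s x) = E' s x by apply: right_limit_eq (rE s _) _ => t; exact: h1.
have e2 : E' s (E s x) = E s x by apply: right_limit_eq (rE' s _) _ => t; exact: h2.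
by rewrite -e1 -cEE' e2.
Qed.

Lemma spectral_familyP A : sa A -> spectral_resolution A (spectral_family A).
Proof.
move=> sA; have [E hE] := spectral_resolution_exists sA.
suff -> : spectral_family A = E by [].
apply: (spectral_family_unique sA hE); apply: getPex.
by exists E; exact: spectral_resolution_family.
Qed.

End SpectralUniqueness.

(** * Functional calculus *)

(** Uniform continuity in a form linear in |u - v|, so that it can be multiplied by the norm of a
    block and combined with operator estimates. *)
Lemma continuous_modulus (R : realType) (f : R -> R) (p q e : R) :
  (forall x, p <= x <= q -> {for x, continuous f}) -> 0 < e ->
  exists2 K : R, 0 < K & forall u v, p <= u <= q -> p <= v <= q ->
    `|f u - f v| <= e + K * `|u - v|.
Proof.
move=> cf e0; have [pq|qp] := leP p q; last first.
  by exists 1 => // u v /andP[pu uq]; have := le_trans pu uq; rewrite leNgt qp.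
have cfw : {within `[p, q], continuous f}.
  by apply: continuous_in_subspaceT => x; rewrite inE /= in_itv /=; exact: cf.
have [u1 _ fM] := EVT_max pq cfw; have [u2 _ fm] := EVT_min pq cfw.
pose M := f u1 - f u2.
have hM u v : p <= u <= q -> p <= v <= q -> `|f u - f v| <= M.
  move=> hu hv; have := fM u; have := fM v; have := fm u; have := fm v.
  rewrite !in_itv /= => /(_ hv) a1 /(_ hu) a2 /(_ hv) a3 /(_ hu) a4.
  by rewrite ler_norml /M; apply/andP; split; lra.
have M0 : 0 <= M by have := hM p p; rewrite subrr normr0 lexx; exact.
pose P (K u : R) := forall v, p <= v <= q -> p <= u <= q -> `|f u - f v| <= e + K * `|u - v|.
have := (compact_near_coveringP _).1 (@segment_compact R p q) R (pinfty_nbhs R) P _.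
case=> [x xpq|K0 [_ hK0]].
  have hx : p <= x <= q by move: xpq; rewrite /= in_itv.
  have e20 : 0 < e / 2 by rewrite divr_gt0.
  have /cvgrPdist_lt /(_ _ e20) [eta /= eta0 heta] := cf x hx.
  (* If v is within eta of x, the two values differ by at most e; otherwise v is at least eta / 2
     away from u, and K |u - v| exceeds the total oscillation M. *)
  exists (ball x (eta / 2), [set K | 2 * M / eta < K]) => /=.
    split; first by apply: nbhsx_ballx; rewrite divr_gt0.
    by exists (2 * M / eta); split=> //; exact: num_real.
  move=> [u K] [/= hu hK] v hv hupq.
  have hu2 : `|x - u| < eta / 2 by [].
  have K0 : 0 <= K.
    by apply: le_trans (ltW hK); apply: divr_ge0; [exact: mulr_ge0|exact: ltW].
  have [xv|xv] := ltP `|x - v| eta.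
    have h1 := heta v xv; have h2 : `|f x - f u| < e / 2 by apply: heta => /=; lra.
    have K1 := mulr_ge0 K0 (normr_ge0 (u - v)).
    have := ler_normB (f x - f v) (f x - f u).
    rewrite opprB addrC addrA subrK => h3; lra.
  have huv : eta / 2 <= `|u - v|.
    have := ler_normD (x - u) (u - v); rewrite addrA subrK; lra.
  apply: le_trans (hM u v hupq hv) _.
  have hK2 : 2 * M < K * eta by rewrite -ltr_pdivrMr.
  by have := ler_wpM2l K0 huv; lra.
exists (Num.max K0 0 + 1) => [|u v hu hv].
  by rewrite ltr_wpDl// le_max lexx orbT.
have /hK0 h : K0 < Num.max K0 0 + 1 by rewrite ltr_pwDr// le_max lexx.
by apply: (h u); rewrite //= in_itv.
Qed.

Lemma sqr_le_sum (R : realType) (w u v k l : R) : 0 <= u -> 0 <= v -> 0 <= k -> 0 <= l ->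
  `|w| * u <= k * u + l * v ->
  (`|w| * u) ^+ 2 <= 2 * k ^+ 2 * u ^+ 2 + 2 * l ^+ 2 * v ^+ 2.
Proof.
move=> u0 v0 k0 l0 h.
have h2 : (`|w| * u) ^+ 2 <= (k * u + l * v) ^+ 2.
  by rewrite ler_pXn2r// nnegrE ?addr_ge0 ?mulr_ge0.
by have := sqr_ge0 (k * u - l * v); lra.
Qed.

Section FunctionalCalculus.
Context (R : realType) (H : hilbertType R).
Implicit Types (A B C S T Y Z : H -> H) (x y z : H) (E : R -> H -> H) (f g : R -> R).

(** Positive invertibility in terms of the quadratic form, see [pos_invertibleP]; m directly bounds
    the spectrum away from 0. *)
Definition coercive A := sa A /\ exists2 m : R, 0 < m & forall x, m * ip x x <= ip (A x) x.

(* The norm-continuous functional calculus, characterized by what f(A) does to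
   approximate eigenvectors of A. *)
Definition fun_approx A f Y := forall p q e : R, 0 < p -> 0 < e ->
  exists2 d : R, 0 < d & forall c x, p <= c <= q ->
    nrm (A x - c%:C *: x) <= d * nrm x -> nrm (Y x - (f c)%:C *: x) <= e * nrm x.

Lemma coercive_carried A : coercive A -> exists a b, [/\ 0 < a, a <= b
  & carried (spectral_family A) a b].
Proof.
move=> [sA [m m0 hm]]; have [k k0 hk] := bop_bound sA.1.
have hM x : ip (A x) x <= Num.max m k * ip x x.
  apply: le_trans (ip_le_nrm _ _) _; rewrite -nrm2 expr2 mulrA ler_wpM2r ?nrm_ge0//.
  by apply: le_trans (hk x) _; rewrite ler_wpM2r ?nrm_ge0// le_max lexx orbT.
(* m / 2 is positive and strictly below m; the maximum guarantees a <= b even on the zero space,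
   where k may be smaller than m. *)
exists (m / 2), (Num.max m k); split; first by rewrite divr_gt0.
  by apply: (@le_trans _ _ m); rewrite ?le_max ?lexx//; lra.
by apply: (spectral_carried (spectral_familyP sA) hm hM) => //; lra.
Qed.

Lemma fun_approx_integral A f Y a b : sa A -> 0 < a -> carried (spectral_family A) a b ->
  bounded_op Y -> (forall s, opcomm Y (spectral_family A s)) -> fun_approx A f Y ->
  is_spectral_integral (spectral_family A) a b f Y.
Proof.
move=> sA a0 cE bY YE hY; apply: (spectral_integralP sA (spectral_familyP sA)) => // e e0.
by have [d d0 hd] := hY a b e a0 e0; exists d.
Qed.

(** The operator chosen by [op_fun] comes with an unknown interval; as [fun_approx] covers every
    compact part of ]0, +oo[, Y is the integral over that interval too. *)
Lemma op_fun_eq A f Y : coercive A -> bounded_op Y ->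
  (forall s, opcomm Y (spectral_family A s)) -> fun_approx A f Y -> op_fun f A = Y.
Proof.
move=> pA bY YE hY; have sA := pA.1.
have [bF [a [b [a0 cE iE]]]] : [set Y | bounded_op Y /\ exists a b, [/\ 0 < a,
    carried (spectral_family A) a b
    & is_spectral_integral (spectral_family A) a b f Y]] (op_fun f A).
  apply: getPex; exists Y; split=> //; have [a [b [a0 _ cE]]] := coercive_carried pA.
  by exists a, b; split=> //; exact: fun_approx_integral.
apply: (spectral_integral_unique _ cE iE); last exact: fun_approx_integral.
exact: spectral_projection_family sA (spectral_familyP sA).
Qed.

Definition positive_continuous f := forall x : R, 0 < x -> {for x, continuous f}.

Section Existence.
Variables (A : H -> H) (f : R -> R).
Hypotheses (pA : coercive A) (cf : positive_continuous f).

Let sA : sa A := pA.1.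
Let E := spectral_family A.
Let hE : spectral_resolution A E := spectral_familyP sA.
Let mE : projection_family E := spectral_projection_family sA hE.

(** Here x meets many blocks, but those with tags far from c carry little of it: |t_i - c| |P_i x|
    is at most the mesh times |P_i x| plus |P_i (A x - c x)|. The bound d depends on no
    partition. *)
Lemma riemann_approx (a b p q e : R) : 0 < a -> carried E a b -> 0 < p -> 0 < e ->
  exists2 d : R, 0 < d & forall s t c x, tagged_partition a b s t -> mesh_lt a b s d ->
    p <= c <= q -> nrm (A x - c%:C *: x) <= d * nrm x ->
    nrm (\sum_(i < size s) (f (t i))%:C *: increment E a b s i x - (f c)%:C *: x) <= e * nrm x.
Proof.
move=> a0 cE p0 e0; have e4 : 0 < e / 4 by rewrite divr_gt0.
have cf' (u : R) : Num.min a p <= u <= Num.max b q -> {for u, continuous f}.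
  by move=> /andP[h _]; apply: cf; apply: lt_le_trans h; rewrite lt_min a0.
have [K K0 hK] := continuous_modulus cf' e4.
(* With K d = e / 4 the blocks give e / 2 and the defect of x gives e / 4; the squares add up to 2
   (e / 2)^2 + 2 (e / 4)^2 < e^2. *)
exists (e / (4 * K)) => [|s t c x ps ms hc hx]; first by rewrite divr_gt0 ?mulr_gt0.
set d := e / (4 * K) in ms hx.
have Kd : K * d = e / 4 by rewrite /d; field; rewrite gt_eqF.
have hres := increment_resolution mE cE ps; have [sP PP Pij P1] := hres.
have bA := sA.1.
have AP : forall i : 'I_(size s), opcomm A (increment E a b s i).
  by move=> i; apply: increment_comm => // u; exact: spectral_comm.
have bound (i : 'I_(size s)) : `|f (t i) - f c| * nrm (increment E a b s i x)
    <= e / 2 * nrm (increment E a b s i x)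
       + K * nrm (increment E a b s i (A x - c%:C *: x)).
  set P := increment E a b s i; have n0 := nrm_ge0 (P x).
  have [bP _] : sa P := sP i.
  have [h1 h2] := increment_fixed mE ps (ltn_ord i) (PP i x).
  have /andP[t1 t2] := ps.2 _ (ltn_ord i).
  have ti := partition_tag ps (ltn_ord i).
  have loc : nrm (A (P x) - (t i)%:C *: P x) <= d * nrm (P x).
    apply: le_trans (spectral_local sA hE _ h1 h2) _; first by rewrite t1 t2.
    by apply: ler_wpM2r => //; exact/ltW/ms.
  have fK : `|f (t i) - f c| <= e / 4 + K * `|t i - c|.
    apply: hK; apply/andP; split; rewrite ?ge_min ?le_max.
    - by have /andP[-> _] := ti.
    - by have /andP[_ ->] := ti.
    - by have /andP[-> _] := hc; rewrite orbT.
    - by have /andP[_ ->] := hc; rewrite orbT.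
  have tc : `|t i - c| * nrm (P x) <= d * nrm (P x) + nrm (P (A x - c%:C *: x)).
    rewrite -nrmZ rmorphB scalerBl.
    have -> : P (A x - c%:C *: x) = A (P x) - c%:C *: P x.
      by rewrite (bopB bP) (bopZ bP) (AP i).
    have := nrmD ((t i)%:C *: P x - A (P x)) (A (P x) - c%:C *: P x).
    rewrite nrmC in loc; rewrite addrA subrK => h; lra.
  have := ler_wpM2r n0 fK; have := ler_wpM2l (ltW K0) tc.
  have : K * (d * nrm (P x)) = e / 4 * nrm (P x) by rewrite mulrA Kd.
  by move=> *; lra.
set W := \sum_(i < _) _.
have -> : W - (f c)%:C *: x = \sum_(i < size s) (f (t i) - f c)%:C *: increment E a b s i x.
  rewrite -[in X in _ - X](P1 x) scaler_sumr -sumrB; apply: eq_bigr => i _.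
  by rewrite rmorphB scalerBl.
apply: ler_nrm2; first by rewrite mulr_ge0 ?nrm_ge0 ?ltW.
rewrite -nrm2 (resolution_norm _ hres).
have eqP (i : 'I_(size s)) : increment E a b s i
    (\sum_(j < size s) (f (t j) - f c)%:C *: increment E a b s j x)
   = (f (t i) - f c)%:C *: increment E a b s i x.
  have := combination_res_comm (fun i : 'I_(size s) => f (t i) - f c) i hres x.
  by rewrite combination_res// => <-.
apply: (@le_trans _ _ (\sum_(i < size s) (2 * (e / 2) ^+ 2 * nrm (increment E a b s i x) ^+ 2
   + 2 * K ^+ 2 * nrm (increment E a b s i (A x - c%:C *: x)) ^+ 2))).
  apply: ler_sum => i _; rewrite eqP nrmZ; apply: sqr_le_sum => //; rewrite ?nrm_ge0//.
    by rewrite divr_ge0 ?(ltW e0).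
  exact: ltW.
rewrite big_split /= -!mulr_sumr -!(resolution_norm _ hres).
have h1 : nrm (A x - c%:C *: x) ^+ 2 <= (d * nrm x) ^+ 2.
  by rewrite ler_pXn2r// nnegrE ?(le_trans _ hx) ?nrm_ge0.
have h2 : K ^+ 2 * (d * nrm x) ^+ 2 = (e / 4) ^+ 2 * nrm x ^+ 2 by rewrite -Kd; ring.
have := ler_wpM2l (sqr_ge0 K) h1; rewrite h2.
have := mulr_ge0 (sqr_ge0 e) (sqr_ge0 (nrm x)); rewrite exprMn; lra.
Qed.

End Existence.
End FunctionalCalculus.

(** * Existence and coercivity of f(A) *)

Section Existence.
Context (R : realType) (H : hilbertType R).
Implicit Types (Z : H -> H) (x : H).
Variables (A : H -> H) (f : R -> R).
Hypotheses (pA : coercive A) (cf : positive_continuous f).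

Let sA : sa A := pA.1.
Let E := spectral_family A.
Let hE : spectral_resolution A E := spectral_familyP sA.
Let mE : projection_family E := spectral_projection_family sA hE.

(** Y is the norm limit of Riemann sums. To compare two of them, test on the blocks of one: these
    are approximate eigenvectors, on which [riemann_approx] puts both sums close to f at the tag. *)
Lemma op_fun_exists : exists Y, [/\ sa Y,
  forall Z, sa Z -> opcomm Z A -> opcomm Z Y & fun_approx A f Y].
Proof.
have [a [b [a0 ab cE]]] := coercive_carried pA.
have ex (n : nat) : exists st : seq R * (nat -> R),
    tagged_partition a b st.1 st.2 /\ mesh_lt a b st.1 n.+1%:R^-1.
  have n0 : 0 < n.+1%:R^-1 :> R by rewrite invr_gt0.
  by have [s [t hst]] := fine_partition ab n0; exists (s, t).
have [st hst] := choice ex.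
pose W (n : nat) x := \sum_(i < size (st n).1)
  (f ((st n).2 i))%:C *: increment E a b (st n).1 i x.
have hres n := increment_resolution mE cE (hst n).1.
have saW n : sa (W n).
  by apply: sa_sum => i; apply: saZ; case: (hres n).
have commW Z n : bounded_op Z -> (forall u, opcomm Z (E u)) -> opcomm Z (W n).
  move=> bZ ZE x; rewrite /W (bop_sum bZ); apply: eq_bigr => i _.
  by rewrite (bopZ bZ); congr (_ *: _); exact: increment_comm.
have commE u v : opcomm (E u) (E v) by exact: spectral_comm2 hE _ _.
have bE u : bounded_op (E u).
  by have /orthogonal_projectionP[[]] := mE.1 u.
have approxW (p q e : R) : 0 < p -> 0 < e -> exists2 d : R, 0 < d & exists N, forall n,
    (N <= n)%N -> n.+1%:R^-1 <= d /\ forall c x, p <= c <= q ->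
    nrm (A x - c%:C *: x) <= d * nrm x -> nrm (W n x - (f c)%:C *: x) <= e * nrm x.
  move=> p0 e0; have [d d0 hd] := riemann_approx pA cf q a0 cE p0 e0.
  exists d => //; have [N hN] := invSn_le d0; exists N => n /hN nd; split=> // c x hc hx.
  apply: hd hc hx; first exact: (hst n).1.
  by move=> i /(hst n).2 /lt_le_trans; apply.
have [Y bY WY] : exists2 Y, bounded_op Y & oplim W Y.
  apply: oplim_exists => [n|e e0]; first exact: (saW n).1.
  have [d d0 [N hN]] := approxW a b _ a0 (divr_gt0 e0 (ltr0n _ 2)).
  exists N => m n Nm Nn; have [[md hm] [_ hn]] := (hN m Nm, hN n Nn).
  have sP := hres m; case: (sP) => spP PP _ _.
  apply: (resolution_bound (Z := W m \- W n) (hres m)) => [i x||i x]; last 2 first.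
  - exact: ltW.
  - set y := increment _ _ _ _ _ x.
    have [h1 h2] := increment_fixed mE (hst m).1 (ltn_ord i) (PP i x).
    have /andP[t1 t2] := (hst m).1.2 _ (ltn_ord i).
    have loc : nrm (A y - ((st m).2 i)%:C *: y) <= d * nrm y.
      apply: le_trans (spectral_local sA hE _ h1 h2) _; first by rewrite t1 t2.
      apply: ler_wpM2r; first exact: nrm_ge0.
      by apply: le_trans md; apply/ltW/(hst m).2.
    have tag := partition_tag (hst m).1 (ltn_ord i).
    have := nrmB (W m y - (f ((st m).2 i))%:C *: y) (W n y - (f ((st m).2 i))%:C *: y).
    rewrite opprB addrA subrK; have := hm _ _ tag loc; have := hn _ _ tag loc => *; lra.
  - have bP := (spP i).1.
    have PE u : opcomm (increment E a b (st m).1 i) (E u).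
      move=> z; apply/esym; apply: increment_comm => // v; exact: commE.
    by rewrite /= (bopB bP) !(commW _ _ bP PE).
exists Y; split; first exact: oplim_sa bY WY saW.
  move=> Z sZ ZA; apply: (oplim_comm sZ.1 WY) => n; apply: commW; first exact: sZ.1.
  by move=> u; case: hE => _ + _ _; exact.
move=> p q e p0 e0; have e20 : 0 < e / 2 by rewrite divr_gt0.
have [d d0 [N hN]] := approxW p q _ p0 e20; have [M hM] := WY _ e20.
exists d => // c x hc hx.
have [_ /(_ c x hc hx) h1] := hN _ (leq_maxl N M).
have h2 := hM _ (leq_maxr N M) x; rewrite nrmC in h2.
have := nrmD (Y x - W (maxn N M) x) (W (maxn N M) x - (f c)%:C *: x).
by rewrite addrA subrK; lra.
Qed.

Lemma op_funP : [/\ sa (op_fun f A),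
  forall Z, sa Z -> opcomm Z A -> opcomm Z (op_fun f A) & fun_approx A f (op_fun f A)].
Proof.
have [Y [sY cY aY]] := op_fun_exists.
suff -> : op_fun f A = Y by [].
apply: op_fun_eq => //; first exact: sY.1.
move=> s; have /orthogonal_projectionP[sEs _] := mE.1 s.
by move=> x; apply/esym/cY => // y; apply/esym/spectral_comm.
Qed.

Lemma op_fun_coercive : (forall u : R, 0 < u -> 0 < f u) -> coercive (op_fun f A).
Proof.
move=> f0; have [sY cY aY] := op_funP; split=> //; set Y := op_fun f A.
have [a [b [a0 ab cE]]] := coercive_carried pA.
have cfw : {within `[a, b], continuous f}.
  apply: continuous_in_subspaceT => x; rewrite inE /= in_itv /= => /andP[ax _].
  by apply: cf; exact: lt_le_trans ax.
have [u] := EVT_min ab cfw; rewrite in_itv /= => /andP[au _] fm.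
have fu0 : 0 < f u by apply: f0; exact: lt_le_trans au.
have fu2 : 0 < f u / 2 by rewrite divr_gt0.
(* f u is the minimum of f on [a, b]; half of it is spent on the error of f(A) against f at the tag
   on each block. *)
exists (f u / 2) => // x.
have [d d0 hd] := aY a b _ a0 fu2.
have [s [t [ps ms]]] := fine_partition ab d0.
have hres := increment_resolution mE cE ps; have [sP PP Pij P1] := hres.
have YE v : opcomm Y (E v).
  move=> y; apply/esym/cY => [|z]; last exact/esym/spectral_comm.
  by have /orthogonal_projectionP[] := mE.1 v.
have YP (i : 'I_(size s)) y := increment_comm a b s i sY.1 YE y.
rewrite -nrm2 (resolution_norm x hres) -[in X in _ <= X](P1 (Y x)) ip_suml mulr_sumr.
apply: ler_sum => i _; rewrite -(PP i (Y x)) (sP i).2 -YP; set y := increment _ _ _ _ _ x.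
have [h1 h2] := increment_fixed mE ps (ltn_ord i) (PP i x).
have /andP[t1 t2] := ps.2 _ (ltn_ord i).
have tag := partition_tag ps (ltn_ord i).
have loc : nrm (A y - (t i)%:C *: y) <= d * nrm y.
  apply: le_trans (spectral_local sA hE _ h1 h2) _; first by rewrite t1 t2.
  by apply: ler_wpM2r; [exact: nrm_ge0|exact/ltW/ms].
have := ip_le_nrm ((f (t i))%:C *: y - Y y) y; rewrite nrmC ipBl ipZl -nrm2.
have := ler_wpM2r (nrm_ge0 y) (hd _ _ tag loc).
have : f u * nrm y ^+ 2 <= f (t i) * nrm y ^+ 2.
  by apply: ler_wpM2r; [exact: sqr_ge0|apply: fm; rewrite in_itv].
move=> *; lra.
Qed.

End Existence.

(** * Inverses of coercive operators *)

Section Coercive.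
Context (R : realType) (H : hilbertType R).
Implicit Types (A B C S T Y Z : H -> H) (x y z : H) (f g : R -> R).

Lemma sa_fun_unique A f Y Y' : coercive A ->
  bounded_op Y -> (forall Z, sa Z -> opcomm Z A -> opcomm Z Y) -> fun_approx A f Y ->
  bounded_op Y' -> (forall Z, sa Z -> opcomm Z A -> opcomm Z Y') -> fun_approx A f Y' ->
  Y = Y'.
Proof.
move=> pA bY cY aY bY' cY' aY'; have hE := spectral_familyP pA.1.
have com Z s : (forall Z', sa Z' -> opcomm Z' A -> opcomm Z' Z) ->
    opcomm Z (spectral_family A s).
  move=> cZ x; apply/esym/cZ => [|y].
    by case: hE => /(_ s) /orthogonal_projectionP[].
  by apply/esym/spectral_comm; [exact: pA.1|exact: hE].
by rewrite -(op_fun_eq pA bY (com Y ^~ cY) aY) (op_fun_eq pA bY' (com Y' ^~ cY') aY').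
Qed.

Lemma coercive_positive A : coercive A -> positive_op A.
Proof.
move=> [sA [m m0 hm]]; apply/positive_opP; split=> // x.
by apply: le_trans (hm x); rewrite mulr_ge0 ?ip_ge0 ?ltW.
Qed.

Lemma positive_continuous_inv : positive_continuous (fun x : R => x^-1).
Proof. by move=> x x0; apply: inv_continuous; rewrite gt_eqF. Qed.

Lemma coercive_norm A : coercive A -> exists2 m : R, 0 < m & forall x, m * nrm x <= nrm (A x).
Proof.
move=> [sA [m m0 hm]]; exists m => // x.
have [/nrm_le0->|n0] := leP (nrm x) 0; first by rewrite nrm0 mulr0 nrm_ge0.
rewrite -(ler_pM2r n0); apply: le_trans (ip_le_nrm _ _).
by apply: le_trans (hm x); rewrite -nrm2 expr2 mulrA.
Qed.

(** B is 1/x applied to A. Both A B and the identity act on approximate eigenvectors as the constant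
    function 1, so [sa_fun_unique] equates them. *)
Lemma coercive_inverse A : coercive A -> exists B, [/\ coercive B, is_inverse A B
  & forall Z, sa Z -> opcomm Z A -> opcomm Z B].
Proof.
move=> pA; have sA := pA.1; have cinv := positive_continuous_inv.
have [sB cB aB] := op_funP pA cinv; set B := op_fun _ A in sB cB aB.
exists B; split=> //.
  by apply: op_fun_coercive => // x; rewrite invr_gt0.
have AB : opcomm A B by apply: cB.
suff h : A \o B = id by split=> //; apply/funext => x /=; rewrite -AB -[A _]/((A \o B) x) h.
have [k k0 hk] := bop_bound sA.1.
apply: (@sa_fun_unique A (fun _ => 1)) => //.
- exact: bounded_op_comp sA.1 sB.1.
- by move=> Z sZ ZA x /=; rewrite ZA cB.
- move=> p q e p0 e0.
  (* A B - 1 is split as A (B - 1/c) + (1/c) (A - c); the two tolerances allow for |A| <= k and 1/c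
     <= 1/p, leaving e / 2 each. *)
  have e2 : 0 < e / (2 * (k + 1)) by rewrite divr_gt0// mulr_gt0// addr_gt0.
  have [d d0 hd] := aB p q _ p0 e2.
  exists (Num.min d (e * p / 2)) => [|c x /andP[pc cq] hx].
    by rewrite lt_min d0 divr_gt0// mulr_gt0.
  have n0 := nrm_ge0 x; have c0 : 0 < c := lt_le_trans p0 pc.
  have hB := hd c x; rewrite pc cq in hB.
  have {}hB : nrm (B x - c^-1%:C *: x) <= e / (2 * (k + 1)) * nrm x.
    by apply: hB => //; apply: le_trans hx _; rewrite ler_wpM2r// ge_min lexx.
  have hA : nrm (A x - c%:C *: x) <= e * p / 2 * nrm x.
    by apply: le_trans hx _; rewrite ler_wpM2r// ge_min lexx orbT.
  have -> : (A \o B) x - 1%:C *: x = A (B x - c^-1%:C *: x) + c^-1%:C *: (A x - c%:C *: x).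
    rewrite (bopB sA.1) (bopZ sA.1) scalerBr addrA subrK scalerA -rmorphM.
    by rewrite mulVf ?gt_eqF.
  apply: le_trans (nrmD _ _) _.
  have h1 : nrm (A (B x - c^-1%:C *: x)) <= e / 2 * nrm x.
    apply: le_trans (hk _) _; apply: le_trans (ler_wpM2l (ltW k0) hB) _.
    rewrite mulrA; apply: ler_wpM2r => //.
    rewrite mulrA ler_pdivrMr; last by rewrite mulr_gt0// addr_gt0.
    by have := mulr_gt0 k0 e0; lra.
  have h2 : nrm (c^-1%:C *: (A x - c%:C *: x)) <= e / 2 * nrm x.
    rewrite nrmZ ger0_norm ?invr_ge0 ?(ltW c0)// mulrC ler_pdivrMr//.
    apply: le_trans hA _; have := ler_wpM2l (mulr_ge0 (ltW e0) n0) pc; lra.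
  by lra.
- exact: bounded_op_id.
- move=> p q e p0 e0; exists 1 => // c x _ _.
  by rewrite rmorph1 scale1r subrr nrm0 mulr_ge0 ?nrm_ge0 ?(ltW e0).
Qed.

Lemma pos_invertibleP A : pos_invertible A <-> coercive A.
Proof.
split=> [[pA [bA [B bB [AB BA]]]]|pA].
  have sA := positive_sa pA; split=> //.
  have [k k0 hk] := bop_bound bB; have [l l0 hl] := bop_bound bA.
  (* |x|^2 <= k^2 |A x|^2 <= k^2 l <A x, x>, where k bounds the inverse and l bounds A. *)
  exists (k ^+ 2 * l)^-1 => [|x]; first by rewrite invr_gt0 mulr_gt0 ?exprn_gt0.
  rewrite mulrC ler_pdivrMr ?mulr_gt0 ?exprn_gt0//.
  have h1 := positive_norm2 pA l0 hl x.
  have h2 := hk (A x); rewrite -[B _]/((B \o A) x) BA /= in h2.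
  have : nrm x ^+ 2 <= (k * nrm (A x)) ^+ 2.
    by rewrite ler_pXn2r// nnegrE ?mulr_ge0 ?nrm_ge0 ?(ltW k0).
  rewrite exprMn nrm2; have := ler_wpM2l (sqr_ge0 k) h1; lra.
have [B [pB AB _]] := coercive_inverse pA.
split; first exact: coercive_positive.
by split; [exact: pA.1.1|exists B => //; exact: pB.1.1].
Qed.

Lemma inverse_eq A B : bounded_op B -> is_inverse A B -> inverse A = B.
Proof.
move=> bB iB; have [_ [h1 h2]] : [set S | bounded_op S /\ is_inverse A S] (inverse A).
  by apply: getPex; exists B.
case: iB => h3 h4; apply/funext => x.
by rewrite -[x in LHS]/(id x) -h3 /= -[LHS]/((inverse A \o A) (B x)) h2.
Qed.

End Coercive.

(** * Operator means *)

Section OperatorMeans.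
Context (R : realType) (H : hilbertType R).
Implicit Types (A B C D S T X Y Z : H -> H) (x y z : H) (f g : R -> R) (phi psi : R -> R -> R).

Lemma positive_coercive A (m : R) : positive_op A -> 0 < m ->
  (forall x, m * nrm x <= nrm (A x)) -> coercive A.
Proof.
move=> pA m0 hm; have sA := positive_sa pA; split=> //.
have [k k0 hk] := bop_bound sA.1.
exists (m ^+ 2 / k) => [|x]; first by rewrite divr_gt0 ?exprn_gt0.
rewrite mulrAC ler_pdivrMr// [leRHS]mulrC; apply: le_trans (positive_norm2 pA k0 hk x).
by rewrite -nrm2 -exprMn ler_pXn2r// nnegrE ?mulr_ge0 ?nrm_ge0 ?(ltW m0).
Qed.

Lemma coercive_conj A C : coercive A -> coercive C -> coercive (C \o A \o C).
Proof.
move=> [sA [m m0 hm]] pC; split; first exact: sa_conj sA pC.1.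
have [k k0 hk] := coercive_norm pC.
exists (m * k ^+ 2) => [|x]; first by rewrite mulr_gt0 ?exprn_gt0.
rewrite /= pC.1.2; apply: le_trans (hm (C x)).
rewrite -mulrA ler_pM2l// -!nrm2 -exprMn ler_pXn2r// nnegrE ?mulr_ge0 ?nrm_ge0 ?(ltW k0)//.
Qed.

Lemma op_sqrt_coercive A : coercive A -> coercive (op_sqrt A).
Proof.
move=> pA; have [pS SS _] := op_sqrtP (coercive_positive pA).
have [m m0 hm] := coercive_norm pA; have [k k0 hk] := bop_bound (positive_sa pS).1.
apply: (@positive_coercive _ (m / k)) => // [|x]; first by rewrite divr_gt0.
rewrite mulrAC ler_pdivrMr// [leRHS]mulrC; apply: le_trans (hm x) _.
by rewrite -{1}SS; exact: hk.
Qed.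

(* The analogue of [fun_approx] for functions of two operators, which need not
   commute. *)
Definition joint_approx A B phi Y := forall p q e : R, 0 < p -> 0 < e ->
  exists2 d : R, 0 < d & forall s t x, p <= s <= q -> p <= t <= q ->
    nrm (A x - s%:C *: x) <= d * nrm x -> nrm (B x - t%:C *: x) <= d * nrm x ->
    nrm (Y x - (phi s t)%:C *: x) <= e * nrm x.

Lemma joint_approx_ext A B phi psi Y : (forall s t, 0 < s -> 0 < t -> phi s t = psi s t) ->
  joint_approx A B phi Y -> joint_approx A B psi Y.
Proof.
move=> h hY p q e p0 e0; have [d d0 hd] := hY p q e p0 e0.
exists d => // s t x ps pt; have /andP[p1 _] := ps; have /andP[p2 _] := pt.
by rewrite -h ?(lt_le_trans p0)//; exact: hd.
Qed.

Lemma joint_approx_r A B : joint_approx A B (fun _ t => t) B.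
Proof. by move=> p q e p0 e0; exists e. Qed.

(** From Y Z - phi psi = Y (Z - psi) + psi (Y - phi). No bound on psi is assumed: a nonzero
    approximate eigenvector itself forces |psi s t| <= l + r, where l bounds Z. *)
Lemma joint_approx_mul A B phi psi Y Z : bounded_op Y -> bounded_op Z ->
  joint_approx A B phi Y -> joint_approx A B psi Z ->
  joint_approx A B (fun s t => phi s t * psi s t) (Y \o Z).
Proof.
move=> bY bZ hY hZ p q e p0 e0.
have [k k0 hk] := bop_bound bY; have [l l0 hl] := bop_bound bZ.
pose r := Num.min 1 (e / (k + l + 1)).
have kl : 0 < k + l + 1 by rewrite !addr_gt0.
have r0 : 0 < r by rewrite lt_min ltr01 divr_gt0.
have r1 : r <= 1 by rewrite ge_min lexx.
have re : r * (k + l + 1) <= e by rewrite -ler_pdivlMr// ge_min lexx orbT.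
have [d1 d10 hd1] := hY p q r p0 r0; have [d2 d20 hd2] := hZ p q r p0 r0.
exists (Num.min d1 d2) => [|s t x ps pt hA hB]; first by rewrite lt_min d10.
have n0 := nrm_ge0 x.
have hy := hd1 s t x ps pt; have hz := hd2 s t x ps pt.
have {}hy : nrm (Y x - (phi s t)%:C *: x) <= r * nrm x.
  by apply: hy; [apply: le_trans hA _|apply: le_trans hB _]; rewrite ler_wpM2r// ge_min lexx.
have {}hz : nrm (Z x - (psi s t)%:C *: x) <= r * nrm x.
  apply: hz; [apply: le_trans hA _|apply: le_trans hB _];
    by rewrite ler_wpM2r// ge_min lexx orbT.
have -> : (Y \o Z) x - (phi s t * psi s t)%:C *: x = Y (Z x - (psi s t)%:C *: x)
    + (psi s t)%:C *: (Y x - (phi s t)%:C *: x).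
  by rewrite (bopB bY) (bopZ bY) scalerBr addrA subrK scalerA -rmorphM mulrC.
apply: le_trans (nrmD _ _) _; rewrite nrmZ.
have h1 := le_trans (hk _) (ler_wpM2l (ltW k0) hz).
have h2 : `|psi s t| * nrm x <= (l + r) * nrm x.
  rewrite -nrmZ; have := nrmD ((psi s t)%:C *: x - Z x) (Z x); rewrite subrK nrmC.
  by have := hl x; lra.
have h3 := ler_wpM2l (normr_ge0 (psi s t)) hy; have h4 := ler_wpM2l (ltW r0) h2.
have h5 := ler_wpM2r n0 re.
have h6 : r * (r * nrm x) <= r * nrm x by rewrite ler_pM2l// ler_piMl.
lra.
Qed.

Lemma joint_approx_inv A B phi Y Z : (forall p q : R, 0 < p -> exists2 r : R, 0 < r &
    forall s t, p <= s <= q -> p <= t <= q -> r <= phi s t) ->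
  bounded_op Z -> is_inverse Y Z -> joint_approx A B phi Y ->
  joint_approx A B (fun s t => (phi s t)^-1) Z.
Proof.
move=> hphi bZ [YZ ZY] hY p q e p0 e0.
have [k k0 hk] := bop_bound bZ; have [r r0 hr] := hphi p q p0.
have e' : 0 < e * r / k by rewrite divr_gt0 ?mulr_gt0.
have [d d0 hd] := hY p q _ p0 e'.
exists d => // s t x ps pt hA hB; have := hd s t x ps pt hA hB.
have := hr s t ps pt; set c := phi s t => rc h; have c0 := lt_le_trans r0 rc.
have -> : Z x - c^-1%:C *: x = - (c^-1%:C *: Z (Y x - c%:C *: x)).
  rewrite (bopB bZ) (bopZ bZ) -[Z (Y x)]/((Z \o Y) x) ZY scalerBr scalerA -rmorphM.
  by rewrite mulVf ?gt_eqF// scale1r opprB.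
rewrite nrmN nrmZ ger0_norm ?invr_ge0 ?(ltW c0)// mulrC ler_pdivrMr//.
apply: le_trans (hk _) _; apply: le_trans (ler_wpM2l (ltW k0) h) _.
rewrite mulrA [k * _]mulrC divfK ?gt_eqF// mulrAC.
by apply: ler_wpM2l => //; rewrite mulr_ge0 ?nrm_ge0 ?(ltW e0).
Qed.

Lemma joint_approx_fun A B D phi f Y : (forall p q : R, 0 < p -> exists r r' : R, 0 < r /\
    forall s t, p <= s <= q -> p <= t <= q -> r <= phi s t <= r') ->
  joint_approx A B phi D -> fun_approx D f Y ->
  joint_approx A B (fun s t => f (phi s t)) Y.
Proof.
move=> hphi hD hY p q e p0 e0; have [r [r' [r0 hr]]] := hphi p q p0.
have [d d0 hd] := hY r r' e r0 e0; have [d' d'0 hd'] := hD p q d p0 d0.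
by exists d' => // s t x ps pt hA hB; apply: hd; [exact: hr|exact: hd'].
Qed.

(** A - s = (S + c) (S - c) with c the root of s, and S + c is bounded below by c because S is
    positive. *)
Lemma joint_approx_sqrt A B : coercive A ->
  joint_approx A B (fun s _ => Num.sqrt s) (op_sqrt A).
Proof.
move=> pA p q e p0 e0; have sp : 0 < Num.sqrt p by rewrite sqrtr_gt0.
have [pS SS _] := op_sqrtP (coercive_positive pA); set S := op_sqrt A in pS SS *.
have bS := (positive_sa pS).1.
exists (e * Num.sqrt p) => [|s t x /andP[ps sq] _ hA _]; first exact: mulr_gt0.
set c := Num.sqrt s; have pc : Num.sqrt p <= c by rewrite ler_wsqrtr.
have c0 := lt_le_trans sp pc.
set y := S x - c%:C *: x.
have Sy : S y + c%:C *: y = A x - s%:C *: x.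
  rewrite /y (bopB bS) (bopZ bS) scalerBr addrA subrK scalerA -rmorphM -expr2 sqr_sqrtr.
    by rewrite -[S (S x)]/((S \o S) x) SS.
  exact: le_trans (ltW p0) ps.
have h1 : c * nrm y <= nrm (A x - s%:C *: x).
  have [/nrm_le0->|y0] := leP (nrm y) 0; first by rewrite nrm0 mulr0 nrm_ge0.
  rewrite -(ler_pM2r y0); apply: le_trans (ip_le_nrm _ _).
  by rewrite -Sy ipDl ipZl -mulrA -expr2 nrm2 lerDr; exact: positive_ip.
rewrite -(ler_pM2l sp); apply: le_trans (ler_wpM2r (nrm_ge0 y) pc) _.
by apply: le_trans h1 _; apply: le_trans hA _; rewrite mulrA [_ * e]mulrC.
Qed.

Section Mean.
Variables (A B : H -> H).
Hypotheses (pA : coercive A) (pB : coercive B).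

Let C := op_sqrt A.
Let pC : coercive C := op_sqrt_coercive pA.

Lemma op_sqrt_inverse : [/\ coercive (inverse C), is_inverse C (inverse C)
  & forall Z, sa Z -> opcomm Z C -> opcomm Z (inverse C)].
Proof.
have [D [pD iD cD]] := coercive_inverse pC.
by rewrite (inverse_eq pD.1.1 iD).
Qed.

Lemma op_mean_coercive f : positive_continuous f -> (forall u : R, 0 < u -> 0 < f u) ->
  coercive (op_mean f A B).
Proof.
move=> cf f0; have [pD _ _] := op_sqrt_inverse; apply: coercive_conj => //.
by apply: op_fun_coercive => //; exact: coercive_conj.
Qed.

Lemma op_mean_comm f Z : positive_continuous f -> sa Z -> opcomm Z A -> opcomm Z B ->
  opcomm Z (op_mean f A B).
Proof.
move=> cf sZ ZA ZB; have [pD _ cD] := op_sqrt_inverse.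
have [_ _ cC] := op_sqrtP (coercive_positive pA).
have ZC : opcomm Z C by apply: cC => //; exact: sZ.1.
have ZD := cD Z sZ ZC.
have [_ cF _] := op_funP (coercive_conj pB pD) cf.
have ZF := cF Z sZ _.
move=> x; rewrite /op_mean /= -/C ZC ZF ?ZC// => y /=.
by rewrite ZD ZB ZD.
Qed.

(** The symbol is built along the formula of the mean, with roots written sqrt: sqrt s for C, its
    inverse, t / s for the conjugate of B, f(t / s), and finally s f(t / s). *)
Lemma op_mean_approx f : positive_continuous f ->
  joint_approx A B (fun s t => s * f (t / s)) (op_mean f A B).
Proof.
move=> cf; have [pD iD _] := op_sqrt_inverse.
have hC := joint_approx_sqrt B pA.
have [sF _ aF] := op_funP (coercive_conj pB pD) cf.
have sqrt_low (p q : R) : 0 < p -> exists2 r : R, 0 < r &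
    forall s t : R, p <= s <= q -> p <= t <= q -> r <= Num.sqrt s.
  move=> p0; exists (Num.sqrt p); first by rewrite sqrtr_gt0.
  by move=> s t /andP[ps _] _; rewrite ler_wsqrtr.
have hD := joint_approx_inv sqrt_low pD.1.1 iD hC.
have hDBD : joint_approx A B (fun s t => t / s) (inverse C \o B \o inverse C).
  have bDB : bounded_op (inverse C \o B).
    by apply: bounded_op_comp; [exact: pD.1.1|exact: pB.1.1].
  have hDB := joint_approx_mul pD.1.1 pB.1.1 hD (@joint_approx_r A B).
  have := joint_approx_mul bDB pD.1.1 hDB hD.
  apply: joint_approx_ext => s t s0 t0.
  by rewrite mulrAC -invfM -expr2 sqr_sqrtr ?(ltW s0)// mulrC.
have quot (p q : R) : 0 < p -> exists r r' : R, 0 < r /\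
    forall s t, p <= s <= q -> p <= t <= q -> r <= t / s <= r'.
  (* q may lie below p or be negative; the maximum keeps both bounds positive. *)
  move=> p0; exists (p / Num.max p q), (Num.max p q / p); split.
    by rewrite divr_gt0// lt_max p0.
  move=> s t /andP[ps sq] /andP[pt tq]; have s0 := lt_le_trans p0 ps.
  have q0 : 0 < Num.max p q by rewrite lt_max p0.
  have sq' : s <= Num.max p q by rewrite le_max sq orbT.
  have tq' : t <= Num.max p q by rewrite le_max tq orbT.
  apply/andP; split; rewrite ler_pdivrMr// mulrAC ler_pdivlMr//.
    by apply: ler_pM => //; exact: ltW.
  by rewrite ler_pM// ltW// (lt_le_trans p0).
have hF := joint_approx_fun quot hDBD aF.
have bCF : bounded_op (C \o op_fun f (inverse C \o B \o inverse C)).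
  by apply: bounded_op_comp; [exact: pC.1.1|exact: sF.1].
have := joint_approx_mul bCF pC.1.1 (joint_approx_mul pC.1.1 sF.1 hC hF) hC.
apply: joint_approx_ext => s t s0 t0.
by rewrite mulrAC -expr2 sqr_sqrtr ?(ltW s0).
Qed.

(** Conjugating (1 - l) + l D B D by C, where D is the inverse of C, returns the weighted sum of A
    and B. *)
Lemma op_mean_affine f (l : R) : 0 <= l <= 1 -> (forall u : R, 0 < u -> f u = 1 - l + l * u) ->
  op_mean f A B = (fun x => (1 - l)%:C *: A x + l%:C *: B x).
Proof.
move=> /andP[l0 l1] hf; have [pD [CD DC] _] := op_sqrt_inverse.
have [_ SS _] := op_sqrtP (coercive_positive pA).
have CDE y : C (inverse C y) = y by rewrite -[LHS]/((C \o inverse C) y) CD.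
have DCE y : inverse C (C y) = y by rewrite -[LHS]/((inverse C \o C) y) DC.
set D := inverse C in CDE DCE pD.
have pG := coercive_conj pB pD; have hE := spectral_familyP pG.1.
have bY : bounded_op (fun x => (1 - l)%:C *: x + l%:C *: (D \o B \o D) x).
  by apply: bounded_opD; apply: bounded_opZ; [exact: bounded_op_id|exact: pG.1.1].
rewrite /op_mean -/C -/D (op_fun_eq pG bY).
- apply/funext => x /=; rewrite (bopD pC.1.1) !(bopZ pC.1.1) CDE DCE.
  by rewrite -[C (C x)]/((C \o C) x) SS.
- move=> s x /=.
  have bE : bounded_op (spectral_family (D \o B \o D) s).
    by case: hE => /(_ s) [].
  by rewrite (bopD bE) !(bopZ bE) -(spectral_comm pG.1 hE).
- move=> p q e p0 e0; exists e => // c x /andP[pc _] hx.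
  rewrite (hf c (lt_le_trans p0 pc)).
  have -> : (1 - l)%:C *: x + l%:C *: (D \o B \o D) x - (1 - l + l * c)%:C *: x
      = l%:C *: ((D \o B \o D) x - c%:C *: x).
    have -> : (1 - l + l * c)%:C *: x = (1 - l)%:C *: x + (l * c)%:C *: x.
      by rewrite -scalerDl -rmorphD.
    by rewrite scalerBr scalerA -rmorphM opprD addrACA subrr add0r.
  rewrite nrmZ ger0_norm//; apply: le_trans hx.
  by rewrite ler_piMl ?nrm_ge0.
Qed.

End Mean.
End OperatorMeans.

(** * Double operator integrals *)

Section DoubleIntegral.
Context (R : realType) (H : hilbertType R).
Implicit Types (A B C D M P S T X Y Z : H -> H) (x y z : H) (E : R -> H -> H)
  (f g : R -> R) (phi : R -> R -> R).

(** Y is tested on all intervals because the one selected by [get] is unknown. *)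
Lemma double_operator_integral_eq A phi X Y : coercive A -> bounded_op Y ->
  (forall a b, 0 < a -> carried (spectral_family A) a b ->
     is_double_operator_integral (spectral_family A) a b phi X Y) ->
  double_operator_integral A phi X = Y.
Proof.
move=> pA bY hY; have mE := spectral_projection_family pA.1 (spectral_familyP pA.1).
have [bD [a [b [a0 cE iD]]]] : [set Y | bounded_op Y /\ exists a b, [/\ 0 < a,
    carried (spectral_family A) a b
    & is_double_operator_integral (spectral_family A) a b phi X Y]]
    (double_operator_integral A phi X).
  apply: getPex; exists Y; split=> //; have [a [b [a0 _ cE]]] := coercive_carried pA.
  by exists a, b; split=> //; exact: hY.
have iY := hY a b a0 cE.
move: iD; set D := double_operator_integral A phi X => iD.
have [ab|triv] := carried_le mE cE; last first.
  by apply/funext => x; rewrite (triv (D x)) (triv (Y x)).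
apply: (@eq_op_approx _ _ _ _ 2) => e x e0.
have [d d0 hd] := iD e e0; have [d' d'0 hd'] := iY e e0.
have dd : 0 < Num.min d d' by rewrite lt_min d0.
have [s [t [ps ms]]] := fine_partition ab dd.
have ms1 : mesh_lt a b s d by move=> i /ms /lt_le_trans; apply; rewrite ge_min lexx.
have ms2 : mesh_lt a b s d' by move=> i /ms /lt_le_trans; apply; rewrite ge_min lexx orbT.
have := hd _ _ ps ms1 _ _ ps ms1 x; have := hd' _ _ ps ms2 _ _ ps ms2 x.
rewrite !ler_nrm; set W := \sum_(i < _) _ => h1 h2; rewrite nrmC in h2.
by have := nrmD (D x - W) (W - Y x); rewrite addrA subrK => h3; lra.
Qed.

(** A unitary together with its adjoint as an explicit operator, symmetric in U and V, so that
    conjugations in both directions share their lemmas. *)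
Definition unitary_pair (U V : H -> H) := [/\ bounded_op U, bounded_op V,
  forall x, U (V x) = x, forall x, V (U x) = x & forall x y, ip (U x) y = ip x (V y)].

Lemma unitary_pairC U V : unitary_pair U V -> unitary_pair V U.
Proof. by move=> [bU bV UV VU aUV]; split=> // x y; rewrite ipC -aUV ipC. Qed.

Lemma unitary_norm U V x : unitary_pair U V -> nrm (U x) = nrm x.
Proof.
move=> [_ _ _ VU aUV]; apply/eqP; rewrite -(@eqrXn2 _ 2)// ?nrm_ge0//.
by rewrite !nrm2 aUV VU.
Qed.

Lemma sa_unitary U V A : unitary_pair U V -> sa A -> sa (V \o A \o U).
Proof.
move=> uUV [bA hA]; have [bU bV _ _ aUV] := uUV; have [_ _ _ _ aVU] := unitary_pairC uUV.
split=> [|x y /=]; first by apply: bounded_op_comp => //; exact: bounded_op_comp.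
by rewrite aVU hA aUV.
Qed.

Lemma coercive_unitary U V A : unitary_pair U V -> coercive A -> coercive (V \o A \o U).
Proof.
move=> uUV [sA [m m0 hm]]; split; first exact: sa_unitary.
exists m => // x; have [_ _ _ _ aVU] := unitary_pairC uUV.
by rewrite /= aVU; apply: le_trans (hm (U x)); rewrite -!nrm2 (unitary_norm x uUV).
Qed.

(** The kernel is (1 - l) s + l t; summing out the other variable leaves (1 - l) W + l U W' with two
    Riemann sums for P, and the error is a convex combination of theirs. *)
Lemma double_integral_affine U V P f (l : R) : unitary_pair U V -> coercive P ->
  0 <= l <= 1 -> (forall u : R, 0 < u -> f u = 1 - l + l * u) ->
  double_operator_integral P (fun s t => s * f (t / s)) U =
  (fun x => (1 - l)%:C *: P (U x) + l%:C *: U (P x)).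
Proof.
move=> uUV pP /andP[l0 l1] hf; have [bU bV _ _ _] := uUV; have bP := pP.1.1.
have hE := spectral_familyP pP.1; have mE := spectral_projection_family pP.1 hE.
apply: double_operator_integral_eq => // [|a b a0 cE e e0].
  by apply: bounded_opD; apply: bounded_opZ; exact: bounded_op_comp.
have iP : is_spectral_integral (spectral_family P) a b id P.
  apply: (spectral_integralP pP.1 hE) => //; first exact: spectral_comm pP.1 hE.
  by move=> r r0; exists r.
have [d d0 hd] := iP e e0; exists d => // s t ps ms s' t' ps' ms' x; rewrite ler_nrm.
have [sP _ _ P1] := increment_resolution mE cE ps.
have [sP' _ _ P1'] := increment_resolution mE cE ps'.
have h2 := hd _ _ ps' ms' x; have h1 := hd _ _ ps ms (U x); rewrite !ler_nrm in h1 h2.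
set W := \sum_(i < _) _ in h1; set W' := \sum_(i < _) _ in h2.
cbv beta; have -> : \sum_(i < size s) \sum_(j < size s') (t i * f (t' j / t i))%:C *:
    increment (spectral_family P) a b s i (U (increment (spectral_family P) a b s' j x))
    = (1 - l)%:C *: W + l%:C *: U W'.
  rewrite -[U W']P1 !scaler_sumr -big_split /=; apply: eq_bigr => i _.
  rewrite -{2}[x]P1' /W' !(bop_sum bU) !(bop_sum (sP i).1) !scaler_sumr.
  rewrite -big_split /=; apply: eq_bigr => j _.
  have /andP[ti _] := partition_tag ps (ltn_ord i).
  have /andP[tj _] := partition_tag ps' (ltn_ord j).
  have ti0 := lt_le_trans a0 ti; have tj0 := lt_le_trans a0 tj.
  rewrite (bopZ bU) (bopZ (sP i).1) !scalerA -scalerDl -!rmorphM -rmorphD.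
  congr (_%:C *: _); rewrite hf ?divr_gt0//; field.
  by rewrite gt_eqF.
have -> : (1 - l)%:C *: W + l%:C *: U W' - ((1 - l)%:C *: P (U x) + l%:C *: U (P x))
   = (1 - l)%:C *: (W - P (U x)) + l%:C *: U (W' - P x).
  by rewrite (bopB bU) !scalerBr opprD addrACA.
apply: le_trans (nrmD _ _) _; rewrite !nrmZ (unitary_norm _ uUV) !ger0_norm// ?subr_ge0//.
rewrite (unitary_norm _ uUV) in h1; have l1' : 0 <= 1 - l by rewrite subr_ge0.
have := ler_wpM2l l1' h1; have := ler_wpM2l l0 h2; lra.
Qed.

(* With F_s = U^* E_s U the sum over dE_s U dE_t is U times a sum over
   dF_s dE_t, and the hypothesis makes the projections F_s and E_t commute. *)
Lemma double_integral_commuting U V P f : unitary_pair U V -> coercive P ->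
  positive_continuous f -> (forall u : R, 0 < u -> 0 < f u) -> opcomm (V \o P \o U) P ->
  double_operator_integral P (fun s t => s * f (t / s)) U =
  U \o op_mean f (V \o P \o U) P.
Proof.
move=> uUV pP cf f0 cP; have [bU bV UV VU aUV] := uUV; have bP := pP.1.1.
have hE := spectral_familyP pP.1; have mE := spectral_projection_family pP.1 hE.
have pB := coercive_unitary uUV pP; set B := V \o P \o U in cP pB *.
set M := op_mean f B P.
have bM : bounded_op M := (op_mean_coercive pB pP cf f0).1.1.
set E := spectral_family P in hE mE *.
have sE u : sa (E u) by have /orthogonal_projectionP[] := mE.1 u.
have EP u : opcomm (E u) P by move=> x; apply/esym/spectral_comm; [exact: pP.1|].
have EB u : opcomm (E u) B.
  have [_ cE _ _] := hE; move=> x; apply/esym/cE; [exact: pB.1|exact: cP].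
have sF u : sa (V \o E u \o U) := sa_unitary uUV (sE u).
have FB u : opcomm (V \o E u \o U) B by move=> x; rewrite /B /= !UV EP.
have FP u : opcomm (V \o E u \o U) P.
  have [_ cE _ _] := hE => x /=; rewrite -[P (V _)]VU; congr (V _).
  (* Conjugating [cP] by U shows that U P V commutes with P, hence with each E_u; conjugating back
     gives the claim. *)
  have sQ := sa_unitary (unitary_pairC uUV) pP.1.
  have QE : opcomm (U \o P \o V) (E u).
    apply: cE => // y /=; have := cP (V y); rewrite /B /= UV => h.
    by rewrite -h UV.
  by have := QE (U x); rewrite /= VU => <-.
have ME u : opcomm M (E u) by move=> x; apply/esym/(op_mean_comm pB pP cf (sE u) (EB u) (EP u)).
have MF u : opcomm M (V \o E u \o U).
  by move=> x; apply/esym/(op_mean_comm pB pP cf (sF u) (FB u) (FP u)).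
have EF u v : opcomm (V \o E u \o U) (E v).
  by have [_ cE _ _] := hE; apply: cE; [exact: sF|exact: FP].
apply: double_operator_integral_eq => // [|a b a0 cE e e0].
  exact: bounded_op_comp.
have [d d0 hd] := op_mean_approx pB pP cf b a0 e0.
exists d => // s t ps ms s' t' ps' ms' x; rewrite ler_nrm.
have resP := increment_resolution mE cE ps; have [sP PP Pij P1] := resP.
have resQ := increment_resolution mE cE ps'.
have resF : resolution (fun i : 'I_(size s) => V \o increment E a b s i \o U).
  split=> [i|i y|i j y ij|y]; first exact: sa_unitary.
  - by rewrite /= UV PP.
  - by rewrite /= UV Pij// (bop0 bV).
  - by rewrite /= -(bop_sum bV) P1 VU.
have FQ (i : 'I_(size s)) (j : 'I_(size s')) :
    opcomm (V \o increment E a b s i \o U) (increment E a b s' j).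
  move=> y; apply: increment_comm; first by case: resF => /(_ i)[].
  move=> v z; rewrite /increment /=.
  have /= h1 := EF (nth b (a :: s) i.+1) v z; have /= h2 := EF (nth b (a :: s) i) v z.
  by rewrite !(bopB bV) h1 h2 (bopB (sE v).1).
have resK := resolution_prod resF resQ FQ.
rewrite pair_bigA /=.
pose K (k : 'I_(size s) * 'I_(size s')) :=
  (V \o increment E a b s k.1 \o U) \o increment E a b s' k.2.
have -> : \sum_(p : 'I_(size s) * 'I_(size s')) (t p.1 * f (t' p.2 / t p.1))%:C *:
    increment E a b s p.1 (U (increment E a b s' p.2 x))
    = U (combination K (fun k => t k.1 * f (t' k.2 / t k.1)) x).
  rewrite /combination (bop_sum bU); apply: eq_bigr => k _.
  by rewrite (bopZ bU) /K /= UV.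
rewrite -(bopB bU) (unitary_norm _ uUV).
apply: (combination_approx resK bM) => [k y||k {}x Kx]; last 2 first.
- exact: ltW.
(* A vector fixed by the joint block is fixed by both commuting factors. So U x is an approximate
   eigenvector of P for [t i], that is x is one of B, and x is one of P for [t' j]. *)
- rewrite /= in Kx; set i := k.1 in Kx *; set j := k.2 in Kx *.
  have Ux : U x = increment E a b s i (U (increment E a b s' j x)).
    by have := congr1 U Kx; rewrite UV.
  have PPx : increment E a b s i (U x) = U x by rewrite Ux PP.
  have [_ QQ _ _] := resQ.
  have Qx : increment E a b s' j x = x.
    by have := FQ i j (increment E a b s' j x); rewrite /= QQ Kx.
  have loc (q : seq R) (w : nat -> R) k' y : tagged_partition a b q w -> mesh_lt a b q d ->
      (k' < size q)%N -> increment E a b q k' y = y -> nrm (P y - (w k')%:C *: y) <= d * nrm y.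
    move=> pq mq kq /(increment_fixed mE pq kq)[h1 h2].
    have /andP[t1 t2] := pq.2 _ kq.
    apply: le_trans (spectral_local pP.1 hE _ h1 h2) _; first by rewrite t1 t2.
    by apply: ler_wpM2r; [exact: nrm_ge0|exact/ltW/mq].
  apply: hd; [exact: (partition_tag ps (ltn_ord i))|exact: (partition_tag ps' (ltn_ord j))| |].
    have := loc _ _ _ _ ps ms (ltn_ord i) PPx.
    rewrite -[X in X <= _](unitary_norm _ (unitary_pairC uUV)) (unitary_norm _ uUV).
    by rewrite (bopB bV) (bopZ bV) VU.
  exact: loc ps' ms' (ltn_ord j) Qx.
- have MQ : opcomm M (increment E a b s' k.2) by exact: increment_comm.
  have MFi : opcomm M (V \o increment E a b s k.1 \o U).
    move=> z /=; rewrite /increment /= !(bopB bV) (bopB bM).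
    have h1 := MF (nth b (a :: s) k.1.+1) z; have h2 := MF (nth b (a :: s) k.1) z.
    by move: h1 h2 => /= -> ->.
  by rewrite /K /= -[M (V _)]/(M ((V \o increment E a b s k.1 \o U) _)) MFi /= MQ.
Qed.

End DoubleIntegral.

(** * Polar decompositions and centered operators *)

Section Polar.
Context (R : realType) (H : hilbertType R).
Implicit Types (A B M P S T U V X Y Z : H -> H) (x y z : H) (f g : R -> R).

Lemma adjoint_eq A S : bounded_op S -> is_adjoint A S -> adjoint A = S.
Proof.
move=> bS aS; have [_ h] : [set S | bounded_op S /\ is_adjoint A S] (adjoint A).
  by apply: getPex; exists S.
by apply/funext => y; apply: ip_ext => x; rewrite /ip -h aS.
Qed.

Lemma unitary_adjoint U V : unitary_pair U V -> adjoint U = V.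
Proof. by move=> [bU bV _ _ aUV]; apply: adjoint_eq => //; exact/is_adjoint_ip. Qed.

Section PolarFactors.
Variables (U V M : H -> H).
Hypotheses (uUV : unitary_pair U V) (pM : coercive M).

Lemma op_abs_polar : op_abs (U \o M) = M.
Proof.
have [bU bV UV VU aUV] := uUV; have [bM hM] := pM.1.
apply: op_sqrt_eq; first exact: coercive_positive.
have -> : adjoint (U \o M) = M \o V.
  apply: adjoint_eq; first exact: bounded_op_comp.
  apply/is_adjoint_ip; [exact: bounded_op_comp|exact: bounded_op_comp|].
  by move=> x y /=; rewrite aUV hM.
by apply/funext => x /=; rewrite VU.
Qed.

Lemma unitary_polar_decomposition : polar_decomposition (U \o M) U M.
Proof.
have [bU bV UV VU aUV] := uUV; have [bM hM] := pM.1.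
split=> //; first by rewrite op_abs_polar.
  by split=> // x _; rewrite !nrmE (unitary_norm _ uUV).
have [m m0 hm] := coercive_norm pM.
have U0 x : U x = 0 -> x = 0 by move=> h; rewrite -[x]VU h bop0.
move=> x; split=> [/U0->|/U0 h] /=; first by rewrite (bop0 bM) bop0.
suff -> : x = 0 by rewrite bop0.
by apply: nrm_le0; rewrite -(ler_pM2l m0) mulr0 -(nrm0 H) -h; exact: hm.
Qed.

Lemma polar_factor_polar : polar_factor (U \o M) = U.
Proof.
have [hT _ _ _] : [set W | polar_decomposition (U \o M) W (op_abs (U \o M))]
    (polar_factor (U \o M)).
  apply: getPex; exists U => /=; rewrite op_abs_polar.
  exact: unitary_polar_decomposition.
rewrite op_abs_polar in hT; have [B [_ [MB _] _]] := coercive_inverse pM.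
apply/funext => x; rewrite -[x]/(id x) -MB.
by rewrite -[LHS]/((polar_factor (U \o M) \o M) (B x)) -hT.
Qed.

End PolarFactors.

(** As T is injective, U has zero kernel and the partial isometry is an isometry; its inverse is P
    S, with S the inverse of T, since U P S = T S = 1. Coercivity of P comes from |P x| = |T x|. *)
Lemma invertible_polar T U : invertible_op T -> polar_decomposition T U (op_abs T) ->
  coercive (op_abs T) /\ exists V, unitary_pair U V.
Proof.
move=> [bT [S bS [TS ST]]] [TUP _ [bU isoU] kerU].
have [T' bT' aT'] := adjoint_exists bT.
have ipT := (is_adjoint_ip bT bT').1 aT'.
have pTT : positive_op (T' \o T).
  apply/positive_opP; split; last by move=> x /=; rewrite ipC -ipT ip_ge0.
  by split=> [|x y /=]; [exact: bounded_op_comp|rewrite -ipT ipC -ipT ipC].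
have [pP PP _] := op_sqrtP pTT.
have absE : op_abs T = op_sqrt (T' \o T) by rewrite /op_abs (adjoint_eq bT' aT').
rewrite -absE in pP PP; set P := op_abs T in TUP pP PP *.
have [bP hP] := positive_sa pP.
have nP x : nrm (P x) = nrm (T x).
  apply/eqP; rewrite -(@eqrXn2 _ 2)// ?nrm_ge0// !nrm2 hP.
  by rewrite -[P (P x)]/((P \o P) x) PP /= -ipT.
have STE x : S (T x) = x by rewrite -[LHS]/((S \o T) x) ST.
have TSE x : T (S x) = x by rewrite -[LHS]/((T \o S) x) TS.
have [k k0 hk] := bop_bound bS.
have pos : coercive P.
  apply: (@positive_coercive _ _ P k^-1) => // [|x]; first by rewrite invr_gt0.
  by rewrite mulrC ler_pdivrMr// mulrC nP -{1}[x]STE.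
split=> //; exists (P \o S).
have TE x : T x = U (P x) by rewrite [in LHS]TUP.
have nU x : nrm (U x) = nrm x.
  apply: complexI; rewrite -!nrmE; apply: isoU => y /kerU Ty.
  have -> : y = 0 by rewrite -[y]STE Ty bop0.
  by rewrite innerE !ip0r scaler0 ip0r.
have UV x : U ((P \o S) x) = x by rewrite /= -TE TSE.
have VU x : (P \o S) (U x) = x.
  apply/eqP; rewrite -subr_eq0; apply/eqP/nrm_eq0.
  by rewrite -nU bopB// UV subrr nrm0.
split=> //; first exact: bounded_op_comp.
have ipU x y : ip (U x) (U y) = ip x y.
  have := nrm2D (U x) (U y); rewrite -bopD// !nU nrm2D => h; lra.
by move=> x y; rewrite -[in LHS](UV y) ipU.
Qed.

Definition orbit U V P : set (H -> H) := [set X | exists n : nat,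
  X = iter n V \o P \o iter n U \/ X = iter n U \o P \o iter n V].

Lemma centered_polar U V P : unitary_pair U V -> coercive P ->
  centered (U \o P) <->
  forall X Y, orbit U V P X -> orbit U V P Y -> X \o Y = Y \o X.
Proof.
move=> uUV pP; rewrite /centered (polar_factor_polar uUV pP) (op_abs_polar uUV pP).
by rewrite (unitary_adjoint uUV).
Qed.

Section Orbit.
Variables (U V P : H -> H).
Hypotheses (uUV : unitary_pair U V) (pP : coercive P).

Let UV x : U (V x) = x. Proof. by case: uUV. Qed.
Let VU x : V (U x) = x. Proof. by case: uUV. Qed.
Let uVU : unitary_pair V U := unitary_pairC uUV.

(** The orbit is a two-sided sequence and conjugation shifts it by one; at n = 0 the shift passes
    from one family to the other. *)
Lemma orbit_conj Q X : orbit U V Q X -> orbit U V Q (V \o X \o U).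
Proof.
move=> [n [->|->]]; first by exists n.+1; left; apply/funext => x /=; rewrite -iterSr.
case: n => [|n]; first by exists 1%N; left.
by exists n; right; apply/funext => x /=; rewrite VU -iterS iterSr VU.
Qed.

Lemma orbit_conjr Q X : orbit U V Q X -> orbit U V Q (U \o X \o V).
Proof.
move=> [n [->|->]]; last by exists n.+1; right; apply/funext => x /=; rewrite -iterSr.
case: n => [|n]; first by exists 1%N; right.
by exists n; left; apply/funext => x /=; rewrite UV -iterS iterSr UV.
Qed.

Lemma orbit_self Q : orbit U V Q Q.
Proof. by exists 0%N; left. Qed.

Lemma orbit_ind Q (K : (H -> H) -> Prop) : K Q ->
  (forall X, K X -> K (V \o X \o U)) -> (forall X, K X -> K (U \o X \o V)) ->
  forall X, orbit U V Q X -> K X.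
Proof.
move=> K0 KV KU X [n [->|->]]; elim: n => [//|n ih].
  have -> : iter n.+1 V \o Q \o iter n.+1 U = V \o (iter n V \o Q \o iter n U) \o U.
    by apply/funext => x; rewrite /= -iterSr.
  exact: KV.
have -> : iter n.+1 U \o Q \o iter n.+1 V = U \o (iter n U \o Q \o iter n V) \o V.
  by apply/funext => x; rewrite /= -iterSr.
exact: KU.
Qed.

Lemma orbit_sa Q X : sa Q -> orbit U V Q X -> sa X.
Proof.
move=> sQ; apply: (orbit_ind sQ) => Z sZ; first exact: sa_unitary.
exact: (sa_unitary uVU).
Qed.

(* An operator commuting with the orbit of P commutes with M, and the set of
   such operators is stable under conjugation by U. *)
Lemma orbit_mean f : positive_continuous f -> (forall u : R, 0 < u -> 0 < f u) ->
  (forall X Y, orbit U V P X -> orbit U V P Y -> opcomm X Y) ->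
  forall X Y, orbit U V (op_mean f (V \o P \o U) P) X ->
    orbit U V (op_mean f (V \o P \o U) P) Y -> opcomm X Y.
Proof.
move=> cf f0 comm; set M := op_mean f (V \o P \o U) P.
pose K Z := sa Z /\ forall X, orbit U V P X -> opcomm Z X.
have KV Z : K Z -> K (V \o Z \o U).
  move=> [sZ cZ]; split=> [|X oX x]; first exact: sa_unitary.
  by have /= := cZ _ (orbit_conjr oX) (U x); rewrite !VU => ->; rewrite VU.
have KU Z : K Z -> K (U \o Z \o V).
  move=> [sZ cZ]; split=> [|X oX x]; first exact: (sa_unitary uVU).
  by have /= := cZ _ (orbit_conj oX) (V x); rewrite !UV => ->; rewrite UV.
have KM Z : K Z -> opcomm Z M.
  move=> [sZ cZ]; apply: (op_mean_comm (coercive_unitary uUV pP) pP cf sZ).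
    exact/cZ/orbit_conj/orbit_self.
  exact/cZ/orbit_self.
have KP X : orbit U V P X -> K X.
  by move=> oX; split=> [|Y oY]; [exact: orbit_sa pP.1 oX|exact: comm].
have sM : sa M := (op_mean_coercive (coercive_unitary uUV pP) pP cf f0).1.
have KMM : K M by split=> // X /KP/KM h x; rewrite h.
have KX := orbit_ind KMM KV KU.
move=> X Y /KX kX oY; move: Y oY X kX.
(* Quantifying over all X in K lets a conjugation of Y be undone by the opposite conjugation of X,
   under which K is stable. *)
apply: (@orbit_ind M (fun Y => forall X, K X -> opcomm X Y)) => [|Y ih X kX x|Y ih X kX x].
- exact: KM.
- by have /= := ih _ (KU _ kX) (U x); rewrite !VU => <-; rewrite VU.
- by have /= := ih _ (KV _ kX) (V x); rewrite !UV => <-; rewrite UV.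
Qed.

End Orbit.

End Polar.

(** * Iterates of the induced Aluthge transformation *)

Section Iteration.
Context (R : realType) (H : hilbertType R).
Variables (U V : H -> H) (f : R -> R).
Hypotheses (uUV : unitary_pair U V) (hf : representing_function f).

Let f0 (u : R) : 0 < u -> 0 < f u. Proof. by case: hf => + _ _; exact. Qed.
Let cf : positive_continuous f. Proof. by case: hf => _ []. Qed.

Lemma iterated_meanS (P : H -> H) n : iterated_mean f U P n.+1 =
  op_mean f (V \o iterated_mean f U P n \o U) (iterated_mean f U P n).
Proof. by rewrite /iterated_mean iterS (unitary_adjoint uUV). Qed.

Lemma iterated_mean_coercive (P : H -> H) n : coercive P -> coercive (iterated_mean f U P n).
Proof.
move=> pP; elim: n => [//|n ih]; rewrite iterated_meanS.
by apply: op_mean_coercive => //; exact: coercive_unitary.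
Qed.

(** (1 - l) P U + l U P = U ((1 - l) V P U + l P), as U V = 1. *)
Lemma induced_aluthge_affine (P : H -> H) : coercive P -> weighted_arithmetic f ->
  induced_aluthge f (U \o P) = U \o op_mean f (V \o P \o U) P.
Proof.
move=> pP [l [l01 hl]].
rewrite /induced_aluthge (polar_factor_polar uUV pP) (op_abs_polar uUV pP).
rewrite (double_integral_affine uUV pP l01 hl).
rewrite (op_mean_affine (coercive_unitary uUV pP) pP l01 hl).
have [bU _ UV _ _] := uUV.
by apply/funext => x /=; rewrite (bopD bU) !(bopZ bU) UV.
Qed.

Lemma induced_aluthge_centered (P : H -> H) : coercive P -> centered (U \o P) ->
  induced_aluthge f (U \o P) = U \o op_mean f (V \o P \o U) P /\
  centered (U \o op_mean f (V \o P \o U) P).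
Proof.
move=> pP /(centered_polar uUV pP) cP.
have comm X Y : orbit U V P X -> orbit U V P Y -> opcomm X Y.
  by move=> oX oY x; have /(congr1 (fun g => g x)) := cP X Y oX oY.
split.
  rewrite /induced_aluthge (polar_factor_polar uUV pP) (op_abs_polar uUV pP).
  apply: double_integral_commuting => //; apply: comm; last exact: orbit_self.
  exact/(orbit_conj uUV)/orbit_self.
apply/(centered_polar uUV); first exact: (op_mean_coercive (coercive_unitary uUV pP) pP cf f0).
move=> X Y oX oY; apply/funext => x; exact: (orbit_mean uUV pP cf f0 comm oX oY).
Qed.

End Iteration.

Theorem theorem2p7 (R : realType) (H : hilbertType R) (T U : H -> H)
  (hT : invertible_op T) (hU : polar_decomposition T U (op_abs T))
  (f : R -> R) (hf : representing_function f) :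
  (forall n : nat, pos_invertible (iterated_mean f U (op_abs T) n)) /\
  (weighted_arithmetic f -> forall n : nat,
     polar_decomposition (iter n (induced_aluthge f) T)
       U (iterated_mean f U (op_abs T) n)) /\
  (centered T -> forall n : nat,
     centered (iter n (induced_aluthge f) T) /\
     polar_decomposition (iter n (induced_aluthge f) T)
       U (iterated_mean f U (op_abs T) n)).
Proof.
have [pP [V uUV]] := invertible_polar hT hU.
have pM n := iterated_mean_coercive uUV hf n pP.
have TUP : T = U \o op_abs T by case: hU.
split; first by move=> n; exact/pos_invertibleP.
split=> [wf n|cT n].
  (* A unitary times a coercive operator is already in polar form, so an equality of operators is
     enough. *)
  suff -> : iter n (induced_aluthge f) T = U \o iterated_mean f U (op_abs T) n.
    exact: (unitary_polar_decomposition uUV (pM n)).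
  elim: n => [//|n ih]; rewrite iterS ih (iterated_meanS _ uUV).
  exact: (induced_aluthge_affine uUV (pM n)).
(* Centeredness is carried along the induction, since the next application of the transformation
   relies on it. *)
suff [-> cM] : iter n (induced_aluthge f) T = U \o iterated_mean f U (op_abs T) n /\
    centered (U \o iterated_mean f U (op_abs T) n).
  by split=> //; exact: (unitary_polar_decomposition uUV (pM n)).
elim: n => [|n [ih cM]]; first by split=> //; rewrite -TUP.
rewrite iterS ih (iterated_meanS _ uUV); exact: (induced_aluthge_centered uUV hf (pM n)).
Qed.
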